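(* The Legendre transformation has the following properties. 1. Let $\gamma$ be a smooth plane curve $x=\phi(t)$, $y=\psi(t)$, and let $\gamma^*$ be its dual curve, parametrized by the same parameter $t$. Let $t_0$ be a parameter value with $\phi'(t_0)\neq 0$ (so that the curvature $\kappa$ of $\gamma$ is defined near $t_0$ and the slope $p=\psi'/\phi'$ is finite there). If $\kappa(t_0)\neq 0$, then $\gamma^*$ is regular at $t_0$. If $\kappa(t_0)=0$ and $\kappa'(t_0)\neq 0$, then $\gamma^*$ has a semicubic cusp at $t_0$. 2. Let $n\ge 1$ be an integer and let $\gamma$ be the graph $y=f(x)$ of a smooth function $f$ defined near $0$ such that $$f(0)=\frac{df}{dx}(0)=\cdots=\frac{d^{n}f}{dx^{n}}(0)=0,\qquad \frac{d^{n+1}f}{dx^{n+1}}(0)\neq 0,$$ parametrized by $t=x$. Then in a neighborhood of the origin the dual curve $\gamma^*$ has the form $$X=\alpha t^{n}+o(t^{n}),\qquad Y=\beta t^{n+1}+o(t^{n+1}),\qquad \alpha\beta\neq 0 .$$ 3. The Legendre transformation $\Lambda:J^1\to J^1$ is an involution, that is, $\Lambda^2$ is the identity transformation (equivalently, $\Lambda=\Lambda^{-1}$). Consequently $(\gamma^* )^*=\gamma$ for every smooth plane curve $\gamma$ for which $\gamma^*$ and $(\gamma^* )^*$ are defined.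
   Context: Smooth means $C^\infty$. $J^1$ is $\mathbb{R}^3$ with coordinates $(x,y,p)$ (the space of 1-jets of functions $y(x)$). The Legendre transformation is the map $\Lambda:J^1\to J^1$, $(x,y,p)\mapsto (X,Y,P)$, given by $X=p$, $Y=xp-y$, $P=x$. A plane curve is a smooth parametrized curve $x=\phi(t)$, $y=\psi(t)$. It is singular at $t_0$ if $\phi'(t_0)=\psi'(t_0)=0$, and regular at $t_0$ otherwise; the same terminology is used for curves in the $(X,Y)$-plane. The Legendrian lift (1-graph) of $\gamma$ is the curve $\overline\gamma: x=\phi(t),\ y=\psi(t),\ p=\psi'(t)/\phi'(t)$ in $J^1$. At parameter values where $\phi'=\psi'=0$, the quotient $\psi'/\phi'$ is understood as extended by continuity. The lift is regarded as defined when $\{\phi'\neq0\}$ is dense in the parameter interval and the quotient extends to a continuous finite function $p(t)$ on the whole parameter interval. The dual curve $\gamma^*$ of $\gamma$ is the curve in the $(X,Y)$-plane obtained by lifting $\gamma$ to $\overline\gamma$, applying $\Lambda$, and projecting by $(X,Y,P)\mapsto(X,Y)$; explicitly $X(t)=p(t)$, $Y(t)=\phi(t)p(t)-\psi(t)$. It is regarded as defined when $\overline\gamma$ is defined and the resulting curve is smooth. The double dual $(\gamma^* )^*$ is obtained by applying the same construction to $\gamma^*$, parametrized by the same $t$. $\kappa(t)$ denotes the signed curvature of $\gamma$, $\kappa=(\phi'\psi''-\psi'\phi'')/(\phi'^2+\psi'^2)^{3/2}$. A plane curve has a semicubic cusp at $t_0$ if, after a local diffeomorphism of the plane and a local smooth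 change of the parameter sending $t_0$ to $0$, its germ takes the form $(t^2,t^3)$ (equivalently, in suitable local coordinates it has the form $\alpha t^2+o(t^2)$, $\beta t^3+o(t^3)$ with $\alpha\beta\neq0$). *)

(* Defs.v *)
From Stdlib Require Import Reals.
From Coquelicot Require Import Coquelicot.
Open Scope R_scope.

Definition plane : Type := (R * R)%type.

Definition J1 : Type := (R * R * R)%type.

Definition Legendre (j : J1) : J1 :=
  let '(x, y, p) := j in (p, x * p - y, x).

Definition slope (j : J1) : R := snd j.

Definition front (j : J1) : plane := fst j.

(* Parameter intervals are the open intervals ]a, b[, possibly unbounded. *)
Definition itv (a b : Rbar) (t : R) : Prop := Rbar_lt a t /\ Rbar_lt t b.

(* C^oo on D; only used for open D, where the derivatives computed by
   Derive_n depend on f only through its restriction to D. *)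
Definition smooth_on (D : R -> Prop) (f : R -> R) : Prop :=
  forall (t : R) (k : nat), D t -> ex_derive_n f k t.

Definition xc (c : R -> plane) (t : R) : R := fst (c t).
Definition yc (c : R -> plane) (t : R) : R := snd (c t).

Definition smooth_curve (D : R -> Prop) (c : R -> plane) : Prop :=
  smooth_on D (xc c) /\ smooth_on D (yc c).

Definition singular_at (c : R -> plane) (t0 : R) : Prop :=
  Derive (xc c) t0 = 0 /\ Derive (yc c) t0 = 0.

Definition regular_at (c : R -> plane) (t0 : R) : Prop := ~ singular_at c t0.

Definition curvature (c : R -> plane) (t : R) : R :=
  (Derive (xc c) t * Derive_n (yc c) 2 t - Derive (yc c) t * Derive_n (xc c) 2 t)
  / Rpower (Derive (xc c) t ^ 2 + Derive (yc c) t ^ 2) (3 / 2).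

(* L is the 1-graph of c over D.  The existence of such an L says that the
   1-graph is defined; the density clause makes L unique on D. *)
Definition is_lift (D : R -> Prop) (c : R -> plane) (L : R -> J1) : Prop :=
  (forall (t : R) (eps : posreal), D t ->
     exists s : R, D s /\ ball t eps s /\ Derive (xc c) s <> 0) /\
  (forall t : R, D t -> front (L t) = c t) /\
  (forall t : R, D t -> Derive (xc c) t <> 0 ->
     slope (L t) = Derive (yc c) t / Derive (xc c) t) /\
  (forall t : R, D t -> continuous (fun s : R => slope (L s)) t).

(* d is the dual curve of c over D; d is unconstrained outside D. *)
Definition is_dual (D : R -> Prop) (c d : R -> plane) : Prop :=
  exists L : R -> J1,
    is_lift D c L /\
    (forall t : R, D t -> d t = front (Legendre (L t))) /\
    smooth_curve D d.

Definition smooth_fun2 (U : plane -> Prop) (F : plane -> R) : Prop :=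
  forall (z : plane) (k : nat), U z ->
    ex_diff_n (fun x y : R => F (x, y)) k (fst z) (snd z).

Definition smooth_map2 (U : plane -> Prop) (Phi : plane -> plane) : Prop :=
  smooth_fun2 U (fun z => fst (Phi z)) /\ smooth_fun2 U (fun z => snd (Phi z)).

Definition diffeo2 (U V : plane -> Prop) (Phi Psi : plane -> plane) : Prop :=
  open U /\ open V /\
  (forall z, U z -> V (Phi z) /\ Psi (Phi z) = z) /\
  (forall w, V w -> U (Psi w) /\ Phi (Psi w) = w) /\
  smooth_map2 U Phi /\ smooth_map2 V Psi.

Definition diffeo1 (J K : R -> Prop) (tau sigma : R -> R) : Prop :=
  open J /\ open K /\
  (forall t, J t -> K (tau t) /\ sigma (tau t) = t) /\
  (forall s, K s -> J (sigma s) /\ tau (sigma s) = s) /\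
  smooth_on J tau /\ smooth_on K sigma.

Definition semicubic_cusp (c : R -> plane) (t0 : R) : Prop :=
  exists (U V : plane -> Prop) (Phi Psi : plane -> plane)
         (J K : R -> Prop) (tau sigma : R -> R),
    diffeo2 U V Phi Psi /\ U (c t0) /\
    diffeo1 J K tau sigma /\ J t0 /\ tau t0 = 0 /\
    locally 0 (fun s : R =>
      U (c (sigma s)) /\ Phi (c (sigma s)) = (s ^ 2, s ^ 3)).

Definition graph (f : R -> R) (x : R) : plane := (x, f x).

(* g t = coef * t^m + o(t^m) as t -> 0 *)
Definition has_leading_term (g : R -> R) (coef : R) (m : nat) : Prop :=
  is_domin (locally 0) (fun t : R => t ^ m) (fun t : R => g t - coef * t ^ m).

(* Main.v *)
Require Import Defs.
From Stdlib Require Import Reals Lra Lia Ranalysis5 Factorial.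
From Stdlib Require Import ClassicalEpsilon FunctionalExtensionality.
From Coquelicot Require Import Coquelicot.
Open Scope R_scope.

(** The Legendre transformation pulls the contact form [dY - P dX] back to
    [-(dy - p dx)], and this is what drives all three properties.

    Write [p] for the slope of [gamma], so that the dual curve is [X = p],
    [Y = x p - y].  The relation [y' = p x'] holds on the whole parameter
    interval: it holds where [x' <> 0], such parameters are dense, and both
    sides are continuous.  Differentiating [Y] and cancelling gives the dual
    relation [Y' = x X'] ([dual_contact]).

    Involution.  The relation [Y' = x X'] says that [x] is the slope of the
    dual curve wherever [X' <> 0], hence everywhere by density, and then
    [X x - Y = y] ([double_dual]).

    Graphs.  For a graph, [X = f'] and [Y = t f' - f].  Taylor's formula gives
    the leading coefficients [c / n!] and
    [c / n! - c / (n+1)! = c n / (n+1)!], where [c] is the derivative of order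
    [n+1] of [f] at [0] ([graph_dual_leading_terms]).

    Curvature.  Where [x' <> 0], [X'] is the product of the curvature and a
    nonvanishing function.  A nonzero curvature therefore makes the dual
    regular.  A simple zero of the curvature gives [X' = 0] and [X'' <> 0],
    while [Y' = m X'] with [m = x] and [m' <> 0]; the conclusion is then
    [cusp_criterion], which is where the work lies.  A square root turns [X] into
    [X0 + e s^2] with [e = 1] or [e = -1], for a new parameter [s]
    ([morse_point]).  Splitting the other coordinate, after subtracting its
    tangent direction, into even and odd parts in [s] gives
    [E(s^2) + s^3 W(s^2)] with [W(0) <> 0] ([even_odd_normal_form]), so that
    with [x = e (X - X0)] the local diffeomorphism
    [(x, y) |-> (x, (y - E(x)) / W(x))] carries the curve to [(s^2, s^3)].

    The functions [E] and [W] have to be smooth on both sides of [0], although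
    the curve only determines them on nonnegative arguments.  This is Whitney's
    theorem that a smooth even function is a smooth function of the square of
    its argument ([whitney_even]).  The values for negative arguments come from
    Borel's lemma: any sequence of numbers is the sequence of derivatives at
    [0] of a smooth function ([borel]). *)

(** * Calculus of smooth functions on open sets *)

(** Proof principle for smoothness: a class of functions that is stable under
    differentiation consists of smooth functions.  Most smoothness proofs below
    only exhibit such a class, which avoids formulas for iterated
    derivatives. *)
Lemma smooth_on_coind (D : R -> Prop) (S : (R -> R) -> Prop) :
  open D ->
  (forall f, S f -> exists f', S f' /\ forall x, D x -> is_derive f x (f' x)) ->
  forall f, S f -> smooth_on D f.
Proof.
intros oD HS.
assert (claim : forall k f, S f ->
  exists g, S g /\ forall x, D x -> Derive_n f k x = g x).
{ induction k as [|k IH]; intros f Sf.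
  - exists f; split; auto.
  - destruct (IH f Sf) as [g [Sg Hg]].
    destruct (HS g Sg) as [g' [Sg' Hg']].
    exists g'; split; [exact Sg'|].
    intros x Dx; simpl.
    rewrite (Derive_ext_loc _ g).
    + now apply is_derive_unique, Hg'.
    + now apply (filter_imp D); [apply Hg|apply oD]. }
intros f Sf t k Dt.
destruct k as [|k]; [exact I|].
destruct (claim k f Sf) as [g [Sg Hg]].
destruct (HS g Sg) as [g' [_ Hg']].
apply (ex_derive_ext_loc g).
- apply (filter_imp D); [intros; symmetry; now apply Hg|now apply oD].
- exists (g' t); now apply Hg'.
Qed.

Lemma smooth_on_ex_derive D f t : smooth_on D f -> D t -> ex_derive f t.
Proof. intros Hf Dt; exact (Hf t 1%nat Dt). Qed.

Lemma smooth_on_is_derive D f t :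
  smooth_on D f -> D t -> is_derive f t (Derive f t).
Proof. intros Hf Dt; apply Derive_correct; now apply (smooth_on_ex_derive D). Qed.

Lemma smooth_on_continuous D f t : smooth_on D f -> D t -> continuous f t.
Proof.
intros Hf Dt; apply (ex_derive_continuous (V := R_NormedModule) f).
now apply (smooth_on_ex_derive D).
Qed.

Lemma smooth_on_Derive D f : smooth_on D f -> smooth_on D (Derive f).
Proof.
intros Hf t k Dt.
destruct k as [|k]; [exact I|].
apply (ex_derive_ext (Derive_n f (S k))).
- intros x; replace (S k) with (k + 1)%nat by lia.
  now rewrite <- Derive_n_comp.
- exact (Hf t (S (S k)) Dt).
Qed.

Lemma smooth_on_sub (D D' : R -> Prop) f :
  (forall x, D' x -> D x) -> smooth_on D f -> smooth_on D' f.
Proof. intros sub Hf t k Dt; apply Hf; auto. Qed.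

Lemma smooth_on_ext (D : R -> Prop) f g :
  open D -> (forall x, D x -> f x = g x) -> smooth_on D f -> smooth_on D g.
Proof.
intros oD E Hf.
apply (smooth_on_coind D (fun h => exists h0, smooth_on D h0 /\
   forall x, D x -> h0 x = h x)); [exact oD| |now exists f].
intros h [h0 [Sh0 Eh]]; exists (Derive h0); split.
- exists (Derive h0); split; auto; now apply smooth_on_Derive.
- intros x Dx; apply (is_derive_ext_loc h0).
  + apply (filter_imp D); auto.
  + now apply (smooth_on_is_derive D).
Qed.

(** A class stable under differentiation that contains sums, products and
    composites of smooth functions.  Treating the three operations together
    spares the Leibniz and Faa di Bruno formulas. *)
Inductive expr_over (D : R -> Prop) : (R -> R) -> Prop :=
| expr_base f : smooth_on D f -> expr_over D f
| expr_plus f g :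
    expr_over D f -> expr_over D g -> expr_over D (fun x => f x + g x)
| expr_mult f g :
    expr_over D f -> expr_over D g -> expr_over D (fun x => f x * g x)
| expr_comp (E : R -> Prop) f g :
    smooth_on E f -> expr_over D g -> (forall x, D x -> E (g x)) ->
    expr_over D (fun x => f (g x)).

Lemma smooth_expr D f : open D -> expr_over D f -> smooth_on D f.
Proof.
intros oD; apply (smooth_on_coind D (expr_over D) oD); clear f.
intros f Hf; induction Hf as [f Sf|f g Hf [f' [Ef Df]] Hg [g' [Eg Dg]]
  |f g Hf [f' [Ef Df]] Hg [g' [Eg Dg]]|E f g Sf Hg [g' [Eg Dg]] HE].
- exists (Derive f); split.
  + now apply expr_base, smooth_on_Derive.
  + intros x; now apply smooth_on_is_derive.
- exists (fun x => f' x + g' x); split; [now constructor|].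
  intros x Dx; apply (is_derive_plus f g); auto.
- exists (fun x => f' x * g x + f x * g' x); split.
  + now apply expr_plus; apply expr_mult.
  + intros x Dx; apply (is_derive_mult f g); auto.
    intros; apply Rmult_comm.
- exists (fun x => g' x * Derive f (g x)); split.
  + apply expr_mult; [exact Eg|].
    apply (expr_comp D E (Derive f) g); auto; now apply smooth_on_Derive.
  + intros x Dx; apply (is_derive_comp f g); auto.
    now apply (smooth_on_is_derive E); auto.
Qed.

Lemma smooth_plus D f g : open D ->
  smooth_on D f -> smooth_on D g -> smooth_on D (fun x => f x + g x).
Proof. intros; apply smooth_expr; auto; now apply expr_plus; apply expr_base. Qed.

Lemma smooth_mult D f g : open D ->
  smooth_on D f -> smooth_on D g -> smooth_on D (fun x => f x * g x).
Proof. intros; apply smooth_expr; auto; now apply expr_mult; apply expr_base. Qed.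

Lemma smooth_comp D E f g : open D ->
  smooth_on E f -> smooth_on D g -> (forall x, D x -> E (g x)) ->
  smooth_on D (fun x => f (g x)).
Proof.
intros; apply smooth_expr; auto; apply (expr_comp D E f g); auto.
now apply expr_base.
Qed.

Lemma smooth_affine D a b : open D -> smooth_on D (fun x => a + b * x).
Proof.
intros oD.
apply (smooth_on_coind D (fun f => exists a b, f = fun x => a + b * x) oD);
  [|now exists a, b].
intros f [c [d ->]]; exists (fun x => d + 0 * x); split; [now exists d, 0|].
intros x _; auto_derive; [exact I|ring].
Qed.

Lemma smooth_const D c : open D -> smooth_on D (fun _ => c).
Proof.
intros oD; apply (smooth_on_ext D (fun x => c + 0 * x)); auto.
- intros; ring.
- now apply smooth_affine.
Qed.

Lemma smooth_id D : open D -> smooth_on D (fun x => x).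
Proof.
intros oD; apply (smooth_on_ext D (fun x => 0 + 1 * x)); auto.
- intros; ring.
- now apply smooth_affine.
Qed.

Lemma smooth_scal D c f : open D -> smooth_on D f -> smooth_on D (fun x => c * f x).
Proof. intros; apply smooth_mult; auto; now apply smooth_const. Qed.

Lemma smooth_minus D f g : open D ->
  smooth_on D f -> smooth_on D g -> smooth_on D (fun x => f x - g x).
Proof.
intros oD Hf Hg.
apply (smooth_on_ext D (fun x => f x + (-1) * g x)); auto.
- intros; ring.
- apply smooth_plus; auto; now apply smooth_scal.
Qed.

Lemma smooth_pow D f n : open D -> smooth_on D f -> smooth_on D (fun x => f x ^ n).
Proof.
intros oD Hf; induction n as [|n IH]; simpl.
- now apply smooth_const.
- now apply smooth_mult.
Qed.

Lemma open_neq0 : open (fun x : R => x <> 0).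
Proof. exact (open_neq 0). Qed.

Lemma open_pos : open (fun x : R => 0 < x).
Proof. exact (open_gt 0). Qed.

Lemma smooth_Rinv : smooth_on (fun x => x <> 0) Rinv.
Proof.
apply (smooth_on_coind _ (fun f => exists c n, forall x, f x = c * (/ x) ^ S n)).
- exact open_neq0.
- intros f [c [n Ef]].
  exists (fun x => - c * INR (S n) * (/ x) ^ S (S n)); split.
  + now exists (- c * INR (S n)), (S n).
  + intros x Hx; apply (is_derive_ext (fun x => c * (/ x) ^ S n)); [auto|].
    auto_derive; [exact Hx|].
    change (match n with 0%nat => 1 | S _ => INR n + 1 end) with (INR (S n)).
    cbn [pow]; generalize ((/ x) ^ n) (INR (S n)); intros; field; exact Hx.
- exists 1, 0%nat; intros x; simpl; ring.
Qed.

Lemma smooth_inv D f : open D ->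
  smooth_on D f -> (forall x, D x -> f x <> 0) -> smooth_on D (fun x => / f x).
Proof.
intros oD Hf Hn.
now apply (smooth_comp D (fun x => x <> 0) Rinv f); auto using smooth_Rinv.
Qed.

Lemma smooth_div D f g : open D -> smooth_on D f -> smooth_on D g ->
  (forall x, D x -> g x <> 0) -> smooth_on D (fun x => f x / g x).
Proof.
intros oD Hf Hg Hn; apply smooth_mult; auto; now apply smooth_inv.
Qed.

(** The products of a smooth function by [sqrt] form a stable class because the
    derivative of [sqrt] is [sqrt x / (2 x)]. *)
Lemma smooth_sqrt : smooth_on (fun x => 0 < x) sqrt.
Proof.
apply (smooth_on_coind _ (fun f => exists h, smooth_on (fun x => 0 < x) h /\
  f = fun x => h x * sqrt x)).
- exact open_pos.
- intros f [h [Sh ->]].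
  exists (fun x => (Derive h x + h x / (2 * x)) * sqrt x); split.
  + eexists; split; [|reflexivity].
    apply smooth_plus; [exact open_pos|now apply smooth_on_Derive|].
    apply smooth_div; [exact open_pos|exact Sh| |intros; lra].
    apply smooth_scal; [exact open_pos|apply smooth_id; exact open_pos].
  + intros x Hx.
    auto_derive.
    * split; [now apply (smooth_on_ex_derive (fun x => 0 < x))|now split].
    * assert (Hs : sqrt x * sqrt x = x) by (apply sqrt_sqrt; lra).
      assert (0 < sqrt x) by now apply sqrt_lt_R0.
      replace (2 * x) with (2 * (sqrt x * sqrt x)) by now rewrite Hs.
      change (Derive (fun x0 => h x0) x) with (Derive h x).
      field; lra.
- exists (fun _ => 1); split; [apply smooth_const; exact open_pos|].
  apply functional_extensionality; intros; ring.
Qed.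

(** * Hadamard's lemma *)

Definition Rball (c r x : R) : Prop := Rabs (x - c) < r.

Lemma open_Rball c r : open (Rball c r).
Proof.
intros x Hx; unfold Rball in *.
assert (0 < r - Rabs (x - c)) by lra.
exists (mkposreal _ H); intros y Hy.
change (Rabs (y - x) < r - Rabs (x - c)) in Hy.
replace (y - c) with ((y - x) + (x - c)) by ring.
pose proof (Rabs_triang (y - x) (x - c)); lra.
Qed.

Lemma Rball_center c r : 0 < r -> Rball c r c.
Proof. intros; unfold Rball; replace (c - c) with 0 by ring; now rewrite Rabs_R0. Qed.

Lemma open_contains_Rball (D : R -> Prop) x :
  open D -> D x -> exists r, 0 < r /\ forall y, Rball x r y -> D y.
Proof.
intros oD Dx; destruct (oD x Dx) as [eps He].
exists eps; split; [apply cond_pos|intros y Hy; apply He, Hy].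
Qed.

Lemma Rball_segment c r u x : 0 <= u <= 1 -> Rball c r x -> Rball c r (c + u * (x - c)).
Proof.
unfold Rball; intros Hu Hx.
replace (c + u * (x - c) - c) with (u * (x - c)) by ring.
rewrite Rabs_mult, (Rabs_pos_eq u) by lra.
pose proof (Rabs_pos (x - c)); nra.
Qed.

(** The family of integrals that is stable under differentiation and contains
    the quotient of Hadamard's lemma, which is the case [k = 0] with [h] the
    derivative of the given function. *)
Definition radial_moment (c : R) (k : nat) (h : R -> R) (x : R) : R :=
  RInt (fun u => u ^ k * h (c + u * (x - c))) 0 1.

Lemma is_derive_radial c r k h x u :
  smooth_on (Rball c r) h -> Rball c r (c + u * (x - c)) ->
  is_derive (fun z => u ^ k * h (c + u * (z - c))) x
    (u ^ S k * Derive h (c + u * (x - c))).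
Proof.
intros Sh Hx; auto_derive.
- now apply (smooth_on_ex_derive (Rball c r)).
- replace (c + u * (x + - c)) with (c + u * (x - c)) by ring.
  change (Derive (fun y => h y)) with (Derive h); simpl; ring.
Qed.

Lemma continuous_radial c r k h x u :
  smooth_on (Rball c r) h -> Rball c r (c + u * (x - c)) ->
  continuous (fun u => u ^ k * h (c + u * (x - c))) u.
Proof.
intros Sh Hx.
apply (ex_derive_continuous (V := R_NormedModule)
  (fun u => u ^ k * h (c + u * (x - c))) u).
auto_derive; now apply (smooth_on_ex_derive (Rball c r)).
Qed.

Lemma is_derive_radial_moment c r k h x :
  smooth_on (Rball c r) h -> Rball c r x ->
  is_derive (radial_moment c k h) x (radial_moment c (S k) (Derive h) x).
Proof.
intros Sh Dx.
assert (E01 : Rmin 0 1 = 0 /\ Rmax 0 1 = 1)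
  by (rewrite Rmin_left, Rmax_right by lra; auto).
destruct E01 as [E0 E1].
unfold radial_moment.
erewrite (RInt_ext (fun u => u ^ S k * _)).
- apply (is_derive_RInt_param (fun x u => u ^ k * h (c + u * (x - c)))).
  + apply (filter_imp (Rball c r)); [|now apply open_Rball].
    intros y Hy u Hu; rewrite E0, E1 in Hu.
    eexists; apply (is_derive_radial c r); [exact Sh|now apply Rball_segment].
  + intros u Hu; rewrite E0, E1 in Hu.
    assert (Hxu : Rball c r (c + u * (x - c))) by now apply Rball_segment.
    assert (Cxu : continuity_2d_pt (fun z v => c + v * (z - c)) x u).
    { apply continuity_2d_pt_plus; [apply continuity_2d_pt_const|].
      apply continuity_2d_pt_mult; [apply continuity_2d_pt_id2|].
      apply continuity_2d_pt_minus;
        [apply continuity_2d_pt_id1|apply continuity_2d_pt_const]. }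
    apply (continuity_2d_pt_ext_loc
      (fun z v => v ^ S k * Derive h (c + v * (z - c)))).
    * destruct (open_contains_Rball _ _ (open_Rball c r) Hxu) as [e [He Hin]].
      destruct (Cxu (mkposreal e He)) as [d Hd].
      exists d; intros z v Hz Hv; symmetry; apply is_derive_unique.
      apply (is_derive_radial c r); [exact Sh|].
      apply Hin; now apply Hd.
    * apply continuity_2d_pt_mult.
      -- apply (continuity_1d_2d_pt_comp (fun v => v ^ S k) (fun _ v => v)).
         ++ apply derivable_continuous_pt, derivable_pt_pow.
         ++ apply continuity_2d_pt_id2.
      -- apply (continuity_1d_2d_pt_comp (Derive h)); [|exact Cxu].
         apply continuity_pt_filterlim.
         apply (smooth_on_continuous (Rball c r)); [now apply smooth_on_Derive|].
         exact Hxu.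
  + apply (filter_imp (Rball c r)); [|now apply open_Rball].
    intros y Hy; apply (ex_RInt_continuous (V := R_CompleteNormedModule)).
    intros u Hu; rewrite E0, E1 in Hu.
    apply (continuous_radial c r); [exact Sh|now apply Rball_segment].
- intros u Hu; rewrite E0, E1 in Hu; symmetry; apply is_derive_unique.
  apply (is_derive_radial c r); [exact Sh|apply Rball_segment; [lra|exact Dx]].
Qed.

(** Integrate the derivative of [f] along the segment from [c] to [x]; the
    quotient is smooth by differentiation under the integral sign. *)
Lemma hadamard c r f : smooth_on (Rball c r) f ->
  exists g, smooth_on (Rball c r) g /\
    forall x, Rball c r x -> f x = f c + (x - c) * g x.
Proof.
intros Sf; exists (radial_moment c 0 (Derive f)); split.
- apply (smooth_on_coind (Rball c r) (fun g => exists k h,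
    smooth_on (Rball c r) h /\ g = radial_moment c k h)).
  + apply open_Rball.
  + intros g [k [h [Sh ->]]].
    exists (radial_moment c (S k) (Derive h)); split.
    * exists (S k), (Derive h); split; [now apply smooth_on_Derive|reflexivity].
    * intros x Dx; now apply (is_derive_radial_moment c r).
  + exists 0%nat, (Derive f); split; [now apply smooth_on_Derive|reflexivity].
- intros x Dx; unfold radial_moment.
  assert (E01 : Rmin 0 1 = 0 /\ Rmax 0 1 = 1)
    by (rewrite Rmin_left, Rmax_right by lra; auto).
  destruct E01 as [E0 E1].
  assert (H : is_RInt (fun u => (x - c) * (u ^ 0 * Derive f (c + u * (x - c)))) 0 1
    (minus (f (c + 1 * (x - c))) (f (c + 0 * (x - c))))).
  { apply (is_RInt_derive (fun u => f (c + u * (x - c)))).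
    - intros u Hu; rewrite E0, E1 in Hu.
      auto_derive; [apply (smooth_on_ex_derive (Rball c r)); [exact Sf|]|].
      + now apply Rball_segment.
      + replace (c + u * (x + - c)) with (c + u * (x - c)) by ring.
        change (Derive (fun y => f y)) with (Derive f); simpl; ring.
    - intros u Hu; rewrite E0, E1 in Hu.
      apply (continuous_scal_r (x - c) (fun u => u ^ 0 * Derive f (c + u * (x - c)))).
      apply (continuous_radial c r); [now apply smooth_on_Derive|].
      now apply Rball_segment. }
  apply (is_RInt_unique (V := R_CompleteNormedModule)) in H.
  assert (E := RInt_scal (V := R_CompleteNormedModule)
    (fun u => u ^ 0 * Derive f (c + u * (x - c))) 0 1 (x - c)).
  unfold scal, mult in E; simpl in E; unfold mult in E; simpl in E, H |- *.
  rewrite <- E, H.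
  + unfold minus, plus, opp; simpl.
    replace (c + 1 * (x - c)) with x by ring.
    replace (c + 0 * (x - c)) with c by ring; ring.
  + apply (ex_RInt_continuous (V := R_CompleteNormedModule)).
    intros u Hu; rewrite E0, E1 in Hu.
    apply (continuous_radial c r 0); [now apply smooth_on_Derive|].
    now apply Rball_segment.
Qed.

(** * Smooth inverse functions *)

Lemma Derive_pos_increasing (f : R -> R) (c r : R) :
  (forall x, Rball c r x -> ex_derive f x /\ 0 < Derive f x) ->
  forall x y, Rball c r x -> Rball c r y -> x < y -> f x < f y.
Proof.
intros H x y Dx Dy xy.
assert (Hin : forall z, x <= z <= y -> Rball c r z).
{ unfold Rball in *; intros z Hz; apply Rabs_def2 in Dx, Dy; apply Rabs_def1; lra. }
destruct (MVT_gen f x y (Derive f)) as [z [Hz E]];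
  rewrite ?Rmin_left, ?Rmax_right in * by lra.
- intros z Hz; apply Derive_correct, H, Hin; lra.
- intros z Hz; apply continuity_pt_filterlim, (ex_derive_continuous (V := R_NormedModule) f _).
  apply H, Hin, Hz.
- assert (0 < Derive f z) by (apply H, Hin, Hz).
  nra.
Qed.

(** [f] is increasing near [c], and the derivative of its inverse [g] is
    [1 / f'(g)].  The functions [h o g] with [h] smooth then form a class stable
    under differentiation, which contains [g] itself. *)
Lemma smooth_inverse f c r :
  0 < r -> smooth_on (Rball c r) f -> 0 < Derive f c ->
  exists d K g, 0 < d <= r /\ diffeo1 (Rball c d) K f g.
Proof.
intros r0 Sf f'c.
assert (Hd : exists d, 0 < d <= r /\
  forall x, Rball c d x -> Rball c r x /\ 0 < Derive f x).
{ assert (C : continuous (Derive f) c).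
  { apply (smooth_on_continuous (Rball c r)).
    - now apply smooth_on_Derive.
    - now apply Rball_center. }
  destruct (C (fun y => 0 < y)) as [e He]; [now apply open_pos|].
  exists (Rmin e r); split; [split; [apply Rmin_pos; [apply cond_pos|lra]|apply Rmin_r]|].
  intros x Hx; unfold Rball in *; split.
  - eapply Rlt_le_trans; [exact Hx|apply Rmin_r].
  - apply He; eapply Rlt_le_trans; [exact Hx|apply Rmin_l]. }
destruct Hd as [d [Hd Hpos]].
assert (Df : forall x, Rball c d x -> ex_derive f x /\ 0 < Derive f x).
{ intros x Hx; split; [|now apply Hpos].
  apply (smooth_on_ex_derive (Rball c r)); [exact Sf|now apply Hpos]. }
assert (inc := Derive_pos_increasing f c d Df).
set (K := fun s => exists t, Rball c d t /\ f t = s).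
set (g := fun s => epsilon (inhabits 0) (fun t => Rball c d t /\ f t = s)).
assert (gK : forall s, K s -> Rball c d (g s) /\ f (g s) = s)
  by (intros s Hs; now apply epsilon_spec).
assert (gf : forall t, Rball c d t -> g (f t) = t).
{ intros t Ht; destruct (gK (f t)) as [G1 G2]; [now exists t|].
  destruct (Rtotal_order (g (f t)) t) as [L|[E|L]]; auto;
    apply inc in L; auto; lra. }
assert (brk : forall t, Rball c d t -> exists t1 t2, t1 < t < t2 /\
  forall t', t1 <= t' <= t2 -> Rball c d t').
{ intros t Ht.
  destruct (open_contains_Rball _ _ (open_Rball c d) Ht) as [e [He Hin]].
  exists (t - e / 2), (t + e / 2); split; [lra|].
  intros t' Ht'; apply Hin; unfold Rball; apply Rabs_def1; lra. }
assert (surj : forall t1 t2 s, t1 < t2 -> (forall t', t1 <= t' <= t2 -> Rball c d t') ->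
  f t1 <= s <= f t2 -> K s /\ t1 <= g s <= t2).
{ intros t1 t2 s L Hin Hs.
  assert (Ks : exists t, t1 <= t <= t2 /\ f t = s).
  { destruct (Req_dec (f t1) s) as [E|N1]; [exists t1; split; [lra|auto]|].
    destruct (Req_dec (f t2) s) as [E|N2]; [exists t2; split; [lra|auto]|].
    destruct (IVT_interv (fun t => f t - s) t1 t2) as [t [Ht E]]; try lra.
    - intros a Ha; apply continuity_pt_minus.
      + apply continuity_pt_filterlim, (ex_derive_continuous (V := R_NormedModule) f _).
        apply Df, Hin, Ha.
      + now apply continuity_pt_const.
    - exists t; split; [exact Ht|lra]. }
  destruct Ks as [t [Ht <-]]; split.
  - exists t; auto.
  - rewrite gf; auto. }
exists d, K, g; split; [exact Hd|].
assert (oK : open K).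
{ intros s [t [Ht <-]].
  destruct (brk t Ht) as [t1 [t2 [L Hin]]].
  assert (f t1 < f t) by (apply inc; auto; [apply Hin; lra|lra]).
  assert (f t < f t2) by (apply inc; auto; [apply Hin; lra|lra]).
  apply (filter_imp (fun s => f t1 < s /\ s < f t2)).
  - intros s Hs; apply (surj t1 t2); auto; lra.
  - apply filter_and; [now apply open_gt|now apply open_lt]. }
assert (Dg : forall s, K s -> is_derive g s (/ Derive f (g s))).
{ intros s Ks; destruct (gK s Ks) as [Ht E].
  destruct (brk (g s) Ht) as [t1 [t2 [L Hin]]].
  assert (f t1 < s) by (rewrite <- E; apply inc; auto; [apply Hin; lra|lra]).
  assert (s < f t2) by (rewrite <- E; apply inc; auto; [apply Hin; lra|lra]).
  assert (G1 : g (f t1) = t1) by (apply gf, Hin; lra).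
  assert (G2 : g (f t2) = t2) by (apply gf, Hin; lra).
  assert (Prf : forall a, g (f t1) <= a <= g (f t2) -> derivable_pt f a).
  { intros a Ha; apply ex_derive_Reals_0, Df, Hin; lra. }
  assert (Pin : g (f t1) <= g s <= g (f t2)) by lra.
  assert (ED : derive_pt f (g s) (Prf (g s) Pin) = Derive f (g s)).
  { symmetry; apply is_derive_unique, is_derive_Reals.
    now apply derive_pt_eq_1 with (Prf (g s) Pin). }
  apply is_derive_Reals.
  replace (/ Derive f (g s)) with (1 / derive_pt f (g s) (Prf (g s) Pin))
    by (rewrite ED; unfold Rdiv; ring).
  apply derivable_pt_lim_recip_interv with (lb := f t1) (ub := f t2); try lra.
  - apply (continuity_pt_recip_interv f g t1 t2); try lra.
    + intros x y; intros; apply inc; auto; apply Hin; lra.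
    + intros x H1 H2; apply gK, (surj t1 t2); auto; lra.
    + intros x H1 H2; apply (surj t1 t2); auto; lra.
    + intros a Ha; apply continuity_pt_filterlim,
        (ex_derive_continuous (V := R_NormedModule) f _), Df, Hin, Ha.
  - intros x Hx; apply gK, (surj t1 t2); auto; lra.
  - rewrite ED; destruct (Df (g s) Ht); lra. }
repeat split.
- apply open_Rball.
- exact oK.
- now exists t.
- now apply gf.
- now apply gK.
- now apply gK.
- apply (smooth_on_sub (Rball c r)); [intros; now apply Hpos|exact Sf].
- apply (smooth_on_coind K (fun k => exists h, smooth_on (Rball c d) h /\
    k = fun s => h (g s))); [exact oK| |].
  + intros k [h [Sh ->]].
    exists (fun s => Derive h (g s) / Derive f (g s)); split.
    * exists (fun t => Derive h t / Derive f t); split; [|reflexivity].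
      apply smooth_div; [apply open_Rball|now apply smooth_on_Derive| |].
      -- apply smooth_on_Derive.
         apply (smooth_on_sub (Rball c r)); [intros; now apply Hpos|exact Sf].
      -- intros x Hx; destruct (Df x Hx); lra.
    * intros s Ks; unfold Rdiv; rewrite Rmult_comm.
      apply (is_derive_comp h g); [|now apply Dg].
      apply (smooth_on_is_derive (Rball c d)); [exact Sh|now apply gK].
  + exists (fun t => t); split; [|reflexivity].
    apply smooth_id, open_Rball.
Qed.

(** * Borel's lemma on Taylor coefficients *)

Lemma derivative_chain (D : R -> Prop) (F : nat -> R -> R) :
  open D -> (forall k x, D x -> is_derive (F k) x (F (S k) x)) ->
  smooth_on D (F O) /\ forall k x, D x -> Derive_n (F O) k x = F k x.
Proof.
intros oD HF; split.
- apply (smooth_on_coind D (fun f => exists k, f = F k) oD); [|now exists O].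
  intros f [k ->]; exists (F (S k)); split; [now exists (S k)|auto].
- induction k as [|k IH]; intros x Dx; [reflexivity|simpl].
  rewrite (Derive_ext_loc _ (F k)).
  + now apply is_derive_unique, HF.
  + apply (filter_imp D); auto.
Qed.

Definition everywhere (x : R) : Prop := True.

Lemma open_everywhere : open everywhere.
Proof. exact open_true. Qed.

(** Powers of [sin] serve as the building blocks of Borel's lemma: like the
    monomials [x^n] they vanish to order [n] at [0], but all their derivatives
    are bounded on the line, so that rescaling the variable is enough to make a
    series of them converge. *)
Definition sincos (p q : nat) (x : R) : R := sin x ^ p * cos x ^ q.

Lemma is_derive_sincos p q x :
  is_derive (sincos p q) x
    (INR p * sincos (pred p) (S q) x - INR q * sincos (S p) (pred q) x).
Proof.
unfold sincos; auto_derive; [exact I|].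
destruct p, q; cbn [pow pred]; ring.
Qed.

Lemma smooth_sincos p q : smooth_on everywhere (sincos p q).
Proof.
apply (smooth_on_ext _ (fun x => sincos 1 0 x ^ p * sincos 0 1 x ^ q)).
- exact open_everywhere.
- intros x _; unfold sincos; simpl; now rewrite !Rmult_1_r, Rmult_1_l.
- assert (smooth_on everywhere (sincos 1 0) /\ smooth_on everywhere (sincos 0 1))
    as [S1 S2].
  { split; apply (smooth_on_coind everywhere (fun f => exists a b,
      f = fun x => a * sin x + b * cos x)); try exact open_everywhere;
    try (intros f [a [b ->]]; exists (fun x => (- b) * sin x + a * cos x); split;
      [now exists (- b), a|intros x _; auto_derive; [exact I|ring]]).
    - exists 1, 0; apply functional_extensionality; intros x; unfold sincos; simpl; ring.
    - exists 0, 1; apply functional_extensionality; intros x; unfold sincos; simpl; ring. }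
  apply smooth_mult; try apply smooth_pow; auto; exact open_everywhere.
Qed.

Lemma Derive_n_sincos p q j x :
  Derive_n (sincos p q) (S j) x =
  INR p * Derive_n (sincos (pred p) (S q)) j x
  - INR q * Derive_n (sincos (S p) (pred q)) j x.
Proof.
replace (S j) with (j + 1)%nat by lia.
rewrite <- Derive_n_comp.
rewrite (Derive_n_ext _ (fun x =>
  INR p * sincos (pred p) (S q) x - INR q * sincos (S p) (pred q) x)).
- rewrite Derive_n_minus, !Derive_n_scal_l; [reflexivity| |];
    apply filter_forall; intros y k _;
    apply (smooth_scal everywhere); try exact open_everywhere; try exact I;
    apply smooth_sincos.
- intros t; simpl; apply is_derive_unique, is_derive_sincos.
Qed.

(** Each differentiation replaces a monomial of degree [p + q] in [sin] and
    [cos] by a combination of monomials of the same degree whose coefficients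
    have absolute values adding up to [p + q]. *)
Lemma Derive_n_sincos_bound j : forall p q x,
  Rabs (Derive_n (sincos p q) j x) <= INR (p + q) ^ j.
Proof.
induction j as [|j IH]; intros p q x.
- simpl; unfold sincos.
  rewrite Rabs_mult, <- !RPow_abs.
  assert (B : forall u n, Rabs u <= 1 -> 0 <= Rabs u ^ n <= 1).
  { intros u n Hu; split; [apply pow_le, Rabs_pos|].
    rewrite <- (pow1 n); apply pow_incr; split; [apply Rabs_pos|exact Hu]. }
  destruct (B (sin x) p) as [A1 A2].
  { apply Rabs_le; pose proof (SIN_bound x); lra. }
  destruct (B (cos x) q) as [B1 B2].
  { apply Rabs_le; pose proof (COS_bound x); lra. }
  nra.
- rewrite Derive_n_sincos.
  assert (H1 : Rabs (INR p * Derive_n (sincos (pred p) (S q)) j x)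
    <= INR p * INR (p + q) ^ j).
  { rewrite Rabs_mult, (Rabs_pos_eq (INR p)) by apply pos_INR.
    destruct p as [|p]; [simpl INR; lra|].
    apply Rmult_le_compat_l; [apply pos_INR|].
    replace (S p + q)%nat with (p + S q)%nat by lia; apply IH. }
  assert (H2 : Rabs (INR q * Derive_n (sincos (S p) (pred q)) j x)
    <= INR q * INR (p + q) ^ j).
  { rewrite Rabs_mult, (Rabs_pos_eq (INR q)) by apply pos_INR.
    destruct q as [|q]; [simpl INR; lra|].
    apply Rmult_le_compat_l; [apply pos_INR|].
    replace (p + S q)%nat with (S p + q)%nat by lia; apply IH. }
  unfold Rminus; eapply Rle_trans; [apply Rabs_triang|].
  rewrite Rabs_Ropp; cbn [pow]; rewrite plus_INR at 1; lra.
Qed.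

Lemma Derive_n_sincos_0 j : forall p q,
  ((j < p)%nat -> Derive_n (sincos p q) j 0 = 0) /\
  (j = p -> Derive_n (sincos p q) j 0 = INR (fact p)).
Proof.
induction j as [|j IH]; intros p q; split.
- intros Hp; simpl; unfold sincos; rewrite sin_0, pow_ne_zero by lia; ring.
- intros <-; simpl; unfold sincos; rewrite cos_0, pow1; simpl; ring.
- intros Hp; rewrite Derive_n_sincos.
  rewrite (proj1 (IH (pred p) (S q))), (proj1 (IH (S p) (pred q))) by lia; ring.
- intros <-; rewrite Derive_n_sincos.
  rewrite (proj2 (IH (pred (S j)) (S q))), (proj1 (IH (S (S j)) (pred q)))
    by (simpl; lia).
  rewrite fact_simpl, mult_INR; simpl pred; ring.
Qed.

(** The term [c (sin (l x) / l)^n].  Its derivatives of order less than [n]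
    contain a negative power of the frequency [l], so they are as small as
    wanted when [l] is large; this value of [l] makes them at most [2^-n]. *)
Definition borel_term (n : nat) (c : R) (x : R) : R :=
  let l := 1 + 2 ^ n * (Rabs c * INR n ^ n) in
  c / l ^ n * sincos n 0 (l * x).

Lemma borel_term_scale n c : 1 <= 1 + 2 ^ n * (Rabs c * INR n ^ n).
Proof.
assert (0 <= 2 ^ n * (Rabs c * INR n ^ n)); [|lra].
apply Rmult_le_pos; [apply pow_le; lra|].
apply Rmult_le_pos; [apply Rabs_pos|apply pow_le, pos_INR].
Qed.

Lemma smooth_borel_term n c : smooth_on everywhere (borel_term n c).
Proof.
unfold borel_term.
apply smooth_scal; [exact open_everywhere|].
apply (smooth_comp everywhere everywhere (sincos n 0)); try exact open_everywhere.
- apply smooth_sincos.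
- apply smooth_scal; [exact open_everywhere|apply smooth_id; exact open_everywhere].
- easy.
Qed.

Lemma Derive_n_borel_term n c j x :
  let l := 1 + 2 ^ n * (Rabs c * INR n ^ n) in
  Derive_n (borel_term n c) j x = c / l ^ n * (l ^ j * Derive_n (sincos n 0) j (l * x)).
Proof.
intros l; unfold borel_term; fold l.
rewrite Derive_n_scal_l, Derive_n_comp_scal; [reflexivity|].
apply filter_forall; intros y k _; now apply (smooth_sincos n 0).
Qed.

Lemma borel_term_small n c j x : (j < n)%nat ->
  Rabs (Derive_n (borel_term n c) j x) <= (1 / 2) ^ n.
Proof.
intros jn; rewrite Derive_n_borel_term.
assert (Hl := borel_term_scale n c).
set (l := 1 + 2 ^ n * (Rabs c * INR n ^ n)) in *.
pose proof (Derive_n_sincos_bound j n 0 (l * x)) as HB.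
rewrite Nat.add_0_r in HB.
assert (Hn : 1 <= INR n) by (apply (le_INR 1); lia).
assert (HB' : Rabs (Derive_n (sincos n 0) j (l * x)) <= INR n ^ n).
{ eapply Rle_trans; [exact HB|apply Rle_pow; [exact Hn|lia]]. }
replace (l ^ n) with (l ^ j * (l * l ^ (n - S j)))
  by (rewrite tech_pow_Rmult, <- pow_add; f_equal; lia).
assert (1 <= l ^ (n - S j)) by now apply pow_R1_Rle.
assert (0 < l ^ j) by (apply pow_lt; lra).
set (m := l ^ (n - S j)) in *; set (lj := l ^ j) in *.
set (v := Derive_n (sincos n 0) j (l * x)) in *.
replace (c / (lj * (l * m)) * (lj * v)) with (c * v / (l * m)) by (field; lra).
unfold Rdiv; rewrite !Rabs_mult, (Rabs_pos_eq (/ _)).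
2:{ left; apply Rinv_0_lt_compat; nra. }
apply Rmult_le_reg_r with (l * m); [nra|].
rewrite Rmult_assoc, Rinv_l, Rmult_1_r by nra.
assert (P : (1 * / 2) ^ n * 2 ^ n = 1).
{ rewrite <- Rpow_mult_distr; replace (1 * / 2 * 2) with 1 by field; apply pow1. }
assert (0 < (1 * / 2) ^ n) by (apply pow_lt; lra).
apply Rle_trans with (Rabs c * INR n ^ n).
{ apply Rmult_le_compat_l; [apply Rabs_pos|exact HB']. }
apply Rle_trans with ((1 * / 2) ^ n * l).
- unfold l; rewrite Rmult_plus_distr_l, <- Rmult_assoc, P; lra.
- apply Rmult_le_compat_l; nra.
Qed.

Lemma borel_term_0 n c j : (j <= n)%nat ->
  Derive_n (borel_term n c) j 0 = if Nat.eq_dec j n then c * INR (fact n) else 0.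
Proof.
intros jn; rewrite Derive_n_borel_term.
assert (Hl := borel_term_scale n c).
set (l := 1 + 2 ^ n * (Rabs c * INR n ^ n)) in *.
rewrite Rmult_0_r.
destruct (Derive_n_sincos_0 j n 0) as [H1 H2].
destruct (Nat.eq_dec j n) as [->|N].
- rewrite H2 by reflexivity; field; apply pow_nonzero; lra.
- rewrite H1 by lia; ring.
Qed.

(** A term of index [m] does not change the derivatives at [0] of order less than
    [m], so the coefficients can be chosen one after the other, each correcting
    the derivative of order [m] left by the preceding terms. *)
Fixpoint borel_sum (a : nat -> R) (n : nat) : R -> R :=
  match n with
  | O => fun _ => 0
  | S m => fun x => borel_sum a m x +
      borel_term m ((a m - Derive_n (borel_sum a m) m 0) / INR (fact m)) x
  end.

Lemma smooth_borel_sum a n : smooth_on everywhere (borel_sum a n).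
Proof.
induction n as [|n IH]; simpl.
- apply smooth_const; exact open_everywhere.
- apply smooth_plus; [exact open_everywhere|exact IH|apply smooth_borel_term].
Qed.

Lemma Derive_n_borel_sum a n j x :
  Derive_n (borel_sum a (S n)) j x = Derive_n (borel_sum a n) j x +
    Derive_n (borel_term n ((a n - Derive_n (borel_sum a n) n 0) / INR (fact n))) j x.
Proof.
cbn [borel_sum]; apply Derive_n_plus; apply filter_forall; intros y k _.
- now apply smooth_borel_sum.
- now apply smooth_borel_term.
Qed.

Lemma borel_sum_0 a n k : (k < n)%nat -> Derive_n (borel_sum a n) k 0 = a k.
Proof.
induction n as [|n IH]; intros kn; [lia|].
rewrite Derive_n_borel_sum, borel_term_0 by lia.
destruct (Nat.eq_dec k n) as [->|N].
- field; apply INR_fact_neq_0.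
- rewrite IH by lia; ring.
Qed.

Lemma borel_sum_tail a j x N m : (j < N)%nat ->
  Rabs (Derive_n (borel_sum a (N + m)) j x - Derive_n (borel_sum a N) j x)
  <= 2 * (1 / 2) ^ N - 2 * (1 / 2) ^ (N + m).
Proof.
intros jN; induction m as [|m IH].
- rewrite Nat.add_0_r, !Rminus_diag, Rabs_R0; lra.
- replace (N + S m)%nat with (S (N + m)) by lia.
  rewrite Derive_n_borel_sum.
  set (c := (a _ - _) / _).
  assert (H := borel_term_small (N + m) c j x ltac:(lia)).
  set (u := Derive_n (borel_term _ _) _ _) in *.
  replace (_ + u - _) with ((Derive_n (borel_sum a (N + m)) j x
    - Derive_n (borel_sum a N) j x) + u) by ring.
  eapply Rle_trans; [apply Rabs_triang|]; simpl; lra.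
Qed.

Lemma CVU_borel_sum a j :
  CVU_dom (fun n => Derive_n (borel_sum a n) j) everywhere.
Proof.
apply CVU_dom_cauchy; intros eps.
assert (He : 0 < eps / 4) by (pose proof (cond_pos eps); lra).
destruct (pow_lt_1_zero (1 / 2)) with (y := eps / 4) as [N HN];
  [rewrite Rabs_pos_eq; lra|exact He|].
exists (N + S j)%nat.
assert (B : forall n x, (N + S j <= n)%nat ->
  Rabs (Derive_n (borel_sum a n) j x - Derive_n (borel_sum a (N + S j)) j x) < eps / 2).
{ intros n x Hn.
  replace n with ((N + S j) + (n - (N + S j)))%nat by lia.
  eapply Rle_lt_trans; [apply borel_sum_tail; lia|].
  specialize (HN (N + S j)%nat ltac:(lia)).
  rewrite Rabs_pos_eq in HN by (apply pow_le; lra).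
  assert (0 < (1 / 2) ^ (N + S j + (n - (N + S j)))) by (apply pow_lt; lra).
  lra. }
intros n m x _ Hn Hm.
assert (Bn := B n x Hn); assert (Bm := B m x Hm).
rewrite Rabs_minus_sym in Bm.
replace (Derive_n (borel_sum a n) j x - Derive_n (borel_sum a m) j x) with
  ((Derive_n (borel_sum a n) j x - Derive_n (borel_sum a (N + S j)) j x)
   + (Derive_n (borel_sum a (N + S j)) j x - Derive_n (borel_sum a m) j x)) by ring.
eapply Rle_lt_trans; [apply Rabs_triang|lra].
Qed.

(** The partial sums converge uniformly together with all their derivatives,
    and the derivative of order [k] at [0] is constant from index [k + 1] on. *)
Lemma borel (a : nat -> R) :
  exists b, smooth_on everywhere b /\ forall k, Derive_n b k 0 = a k.
Proof.
set (F := fun (k : nat) (x : R) =>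
  real (Lim_seq (fun n => Derive_n (borel_sum a n) k x))).
destruct (derivative_chain everywhere F) as [SF EF].
- exact open_everywhere.
- intros k x _; unfold F.
  apply (CVU_Derive (fun n => Derive_n (borel_sum a n) k) everywhere).
  + exact open_everywhere.
  + easy.
  + apply CVU_borel_sum.
  + intros n y _; now apply (smooth_borel_sum a n y (S k)).
  + intros n y _; apply continuity_pt_filterlim.
    apply (ex_derive_continuous (V := R_NormedModule) (Derive_n (borel_sum a n) (S k)) y).
    now apply (smooth_borel_sum a n y (S (S k))).
  + apply (CVU_borel_sum a (S k)).
  + exact I.
- exists (F O); split; [exact SF|].
  intros k; rewrite EF by exact I; unfold F.
  rewrite (Lim_seq_ext_loc _ (fun _ => a k)), Lim_seq_const; [reflexivity|].
  exists (S k); intros n Hn; now apply borel_sum_0.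
Qed.

(** * Smooth even functions *)

Definition even_on (r : R) (g : R -> R) : Prop :=
  forall s, Rball 0 r s -> g (- s) = g s.

Lemma Rball_opp r s : Rball 0 r s -> Rball 0 r (- s).
Proof.
unfold Rball; rewrite !Rminus_0_r; now rewrite Rabs_Ropp.
Qed.

Lemma Derive_even r g s : smooth_on (Rball 0 r) g -> even_on r g ->
  Rball 0 r s -> Derive g (- s) = - Derive g s.
Proof.
intros Sg Eg Hs.
assert (H : is_derive (fun x => g (- x)) s (- Derive g (- s))).
{ auto_derive.
  - apply (smooth_on_ex_derive (Rball 0 r)); [exact Sg|now apply Rball_opp].
  - change (Derive (fun x => g x)) with (Derive g); ring. }
assert (H' : is_derive g s (- Derive g (- s))).
{ apply (is_derive_ext_loc (fun x => g (- x))); [|exact H].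
  apply (filter_imp (Rball 0 r)); [exact Eg|now apply open_Rball]. }
apply is_derive_unique in H'; lra.
Qed.

(** The derivative of [g] with respect to the square of the variable: if
    [g s = h (s * s)], this is the function of [s] given by [h' (s * s)].  The value
    at [0] is the limit of the quotient when [g] is even. *)
Definition sq_derivative (g : R -> R) (s : R) : R :=
  if Req_EM_T s 0 then Derive_n g 2 0 / 2 else Derive g s / (2 * s).

(** The derivative of an even function is odd, so it is divisible by [s] by
    Hadamard's lemma. *)
Lemma sq_derivative_smooth_even r g : smooth_on (Rball 0 r) g -> even_on r g ->
  smooth_on (Rball 0 r) (sq_derivative g) /\ even_on r (sq_derivative g).
Proof.
intros Sg Eg; split.
- destruct (hadamard 0 r (Derive g)) as [k [Sk Ek]]; [now apply smooth_on_Derive|].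
  apply (smooth_on_ext _ (fun s => / 2 * k s)).
  + apply open_Rball.
  + intros s Hs.
    assert (H0 : Rball 0 r 0).
    { apply Rball_center; pose proof (Rabs_pos (s - 0)); unfold Rball in Hs; lra. }
    assert (D0 : Derive g 0 = 0).
    { pose proof (Derive_even r g 0 Sg Eg H0) as E; rewrite Ropp_0 in E; lra. }
    unfold sq_derivative; destruct (Req_EM_T s 0) as [->|N].
    * assert (E : Derive (Derive g) 0 = k 0).
      { rewrite (Derive_ext_loc _ (fun s => s * k s)).
        - apply is_derive_unique; auto_derive.
          + now apply (smooth_on_ex_derive (Rball 0 r)).
          + ring.
        - apply (filter_imp (Rball 0 r)); [|now apply open_Rball].
          intros x Hx; rewrite (Ek x Hx), D0; ring. }
      change (Derive_n g 2 0) with (Derive (Derive g) 0); rewrite E; field.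
    * rewrite (Ek s Hs), D0; field; exact N.
  + apply smooth_scal; [apply open_Rball|exact Sk].
- intros s Hs; unfold sq_derivative.
  destruct (Req_EM_T s 0) as [->|N].
  + rewrite Ropp_0; destruct (Req_EM_T 0 0); [reflexivity|lra].
  + destruct (Req_EM_T (- s) 0); [lra|].
    rewrite (Derive_even r g s Sg Eg Hs); field; lra.
Qed.

Lemma Rball_sqrt r x : 0 < r -> Rball 0 (r * r) x -> Rball 0 r (sqrt x).
Proof.
unfold Rball; rewrite !Rminus_0_r; intros r0 Hx.
rewrite Rabs_pos_eq by apply sqrt_pos.
rewrite <- (sqrt_square r) by lra.
destruct (Rle_lt_dec x 0) as [L|L].
- rewrite (sqrt_neg_0 x L); apply sqrt_lt_R0; nra.
- apply sqrt_lt_1_alt; apply Rabs_def2 in Hx; lra.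
Qed.

Lemma Rball_sqr r s : Rball 0 r s -> Rball 0 (r * r) (s * s).
Proof.
unfold Rball; rewrite !Rminus_0_r; intros Hs; rewrite Rabs_mult.
pose proof (Rabs_pos s); nra.
Qed.

(** The candidate for [h] in [g s = h (s * s)] : forced on nonnegative arguments,
    and given by an auxiliary function [B] on negative ones. *)
Definition glue (B g : R -> R) (x : R) : R :=
  if Rlt_dec x 0 then B x else g (sqrt x).

Lemma is_derive_even_sqrt r g x : 0 < r ->
  smooth_on (Rball 0 r) g -> 0 < x -> Rball 0 (r * r) x ->
  is_derive (fun y => g (sqrt y)) x (sq_derivative g (sqrt x)).
Proof.
intros r0 Sg x0 Hx.
assert (s0 : 0 < sqrt x) by now apply sqrt_lt_R0.
unfold sq_derivative; destruct (Req_EM_T (sqrt x) 0) as [E|_]; [lra|].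
auto_derive.
- split; [|auto].
  apply (smooth_on_ex_derive (Rball 0 r)); [exact Sg|now apply Rball_sqrt].
- change (Derive (fun x => g x)) with (Derive g); field; lra.
Qed.

(** Matching values and first derivatives at [0] make the glued function
    differentiable, with a derivative that is again glued from an even function
    and a smooth one.  On the right of [0] the difference quotient is evaluated
    by the mean value theorem. *)
Lemma is_derive_glue r g B x : 0 < r ->
  smooth_on (Rball 0 r) g -> even_on r g -> smooth_on everywhere B ->
  B 0 = g 0 -> Derive B 0 = sq_derivative g 0 ->
  Rball 0 (r * r) x ->
  is_derive (glue B g) x (glue (Derive B) (sq_derivative g) x).
Proof.
intros r0 Sg Eg SB B0 B'0 Hx.
destruct (Rtotal_order x 0) as [L|[->|L]].
- unfold glue at 2; destruct (Rlt_dec x 0) as [_|]; [|lra].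
  apply (is_derive_ext_loc B).
  + apply (filter_imp (fun y => y < 0)); [|now apply (open_lt 0)].
    intros y Hy; unfold glue; destruct (Rlt_dec y 0); [reflexivity|lra].
  + now apply (smooth_on_is_derive everywhere).
- assert (E : glue (Derive B) (sq_derivative g) 0 = sq_derivative g 0).
  { unfold glue; destruct (Rlt_dec 0 0); [lra|now rewrite sqrt_0]. }
  rewrite E; apply is_derive_Reals; intros eps Heps.
  assert (HB : is_derive B 0 (sq_derivative g 0)).
  { rewrite <- B'0; now apply (smooth_on_is_derive everywhere). }
  apply is_derive_Reals in HB; destruct (HB eps Heps) as [d1 Hd1].
  destruct (sq_derivative_smooth_even r g Sg Eg) as [Sg' _].
  assert (C : continuous (fun y => sq_derivative g (sqrt y)) 0).
  { apply (continuous_comp sqrt (sq_derivative g)).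
    - apply continuous_sqrt.
    - rewrite sqrt_0; apply (smooth_on_continuous (Rball 0 r)); [exact Sg'|].
      now apply Rball_center. }
  destruct (C (ball (sq_derivative g (sqrt 0)) (mkposreal eps Heps)))
    as [d2 Hd2]; [apply locally_ball|].
  rewrite sqrt_0 in Hd2.
  assert (Hd : 0 < Rmin (Rmin d1 d2) (r * r)).
  { repeat apply Rmin_pos; try apply cond_pos; nra. }
  exists (mkposreal _ Hd); intros h h0 Hh; simpl in Hh.
  assert (Hh1 : Rabs h < d1).
  { eapply Rlt_le_trans; [exact Hh|eapply Rle_trans; apply Rmin_l]. }
  assert (Hh2 : Rabs h < d2).
  { eapply Rlt_le_trans; [exact Hh|eapply Rle_trans; [apply Rmin_l|apply Rmin_r]]. }
  assert (Hh3 : Rabs h < r * r).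
  { eapply Rlt_le_trans; [exact Hh|apply Rmin_r]. }
  rewrite Rplus_0_l; unfold glue at 2.
  destruct (Rlt_dec 0 0) as [|_]; [lra|]; rewrite sqrt_0.
  unfold glue; destruct (Rlt_dec h 0) as [hn|hp].
  + specialize (Hd1 h h0 Hh1); rewrite Rplus_0_l, B0 in Hd1; exact Hd1.
  + assert (hpos : 0 < h) by lra; rewrite Rabs_pos_eq in Hh2, Hh3 by lra.
    destruct (MVT_gen (fun y => g (sqrt y)) 0 h
      (fun y => sq_derivative g (sqrt y))) as [z [Hz Ez]];
      rewrite ?Rmin_left, ?Rmax_right in * by lra.
    * intros y Hy; apply (is_derive_even_sqrt r); try lra; auto.
      unfold Rball; rewrite Rminus_0_r, Rabs_pos_eq; lra.
    * intros y Hy; apply continuity_pt_filterlim.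
      apply (continuous_comp sqrt g); [apply continuous_sqrt|].
      apply (smooth_on_continuous (Rball 0 r)); [exact Sg|].
      apply Rball_sqrt; [lra|].
      unfold Rball; rewrite Rminus_0_r, Rabs_pos_eq; lra.
    * rewrite sqrt_0, Rminus_0_r in Ez; rewrite Ez.
      replace (sq_derivative g (sqrt z) * h / h) with (sq_derivative g (sqrt z))
        by (field; lra).
      apply Hd2; change (Rabs (z - 0) < d2).
      rewrite Rminus_0_r, Rabs_pos_eq; lra.
- unfold glue at 2; destruct (Rlt_dec x 0) as [|_]; [lra|].
  apply (is_derive_ext_loc (fun y => g (sqrt y))).
  + apply (filter_imp (fun y => 0 < y)); [|now apply (open_gt 0)].
    intros y Hy; unfold glue; destruct (Rlt_dec y 0); [lra|reflexivity].
  + now apply (is_derive_even_sqrt r).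
Qed.

(** Borel's lemma supplies a function whose derivatives at [0] are those that
    the values of [g] impose from the right; the glued functions then form a
    chain of successive derivatives. *)
Lemma whitney_even r g : 0 < r -> smooth_on (Rball 0 r) g -> even_on r g ->
  exists h, smooth_on (Rball 0 (r * r)) h /\
    forall s, Rball 0 r s -> g s = h (s * s).
Proof.
intros r0 Sg Eg.
destruct (borel (fun k => Nat.iter k sq_derivative g 0)) as [b [Sb b0]].
assert (Hk : forall k, smooth_on (Rball 0 r) (Nat.iter k sq_derivative g) /\
  even_on r (Nat.iter k sq_derivative g)).
{ induction k as [|k [IH1 IH2]]; [auto|].
  now apply sq_derivative_smooth_even. }
assert (Sbk : forall k, smooth_on everywhere (Derive_n b k)).
{ induction k as [|k IH]; [exact Sb|now apply smooth_on_Derive]. }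
destruct (derivative_chain (Rball 0 (r * r))
  (fun k => glue (Derive_n b k) (Nat.iter k sq_derivative g))) as [SH _].
- apply open_Rball.
- intros k x Hx; destruct (Hk k).
  apply (is_derive_glue r (Nat.iter k sq_derivative g) (Derive_n b k)); auto.
  exact (b0 (S k)).
- eexists; split; [exact SH|].
  intros s Hs; unfold glue; destruct (Rlt_dec (s * s) 0) as [L|_]; [nra|].
  simpl; replace (sqrt (s * s)) with (Rabs s) by (symmetry; apply sqrt_Rsqr_abs).
  unfold Rabs; destruct (Rcase_abs s); [now rewrite Eg|reflexivity].
Qed.

Lemma smooth_opp_arg r f : smooth_on (Rball 0 r) f ->
  smooth_on (Rball 0 r) (fun s => f (- s)).
Proof.
intros Sf; apply (smooth_comp _ (Rball 0 r) f); [apply open_Rball|exact Sf| |].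
- apply (smooth_on_ext _ (fun x => 0 + (-1) * x)); [apply open_Rball| |].
  + intros; ring.
  + apply smooth_affine, open_Rball.
- exact (Rball_opp r).
Qed.

(** The odd part of [y] is [s] times an even function, so Whitney's theorem
    applies to both parts. *)
Lemma even_odd_splitting r y : 0 < r -> smooth_on (Rball 0 r) y ->
  exists E Q, smooth_on (Rball 0 (r * r)) E /\ smooth_on (Rball 0 (r * r)) Q /\
    forall s, Rball 0 r s -> y s = E (s * s) + s * Q (s * s).
Proof.
intros r0 Sy.
assert (oD := open_Rball 0 r).
assert (Sy' := smooth_opp_arg r y Sy).
destruct (whitney_even r (fun s => / 2 * (y s + y (- s)))) as [E [SE HE]].
- exact r0.
- apply smooth_scal; [exact oD|now apply smooth_plus].
- intros s _; rewrite Ropp_involutive; ring.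
- destruct (hadamard 0 r (fun s => / 2 * (y s - y (- s)))) as [k [Sk Hk]].
  { apply smooth_scal; [exact oD|now apply smooth_minus]. }
  rewrite Ropp_0 in Hk.
  destruct (whitney_even r k) as [Q [SQ HQ]]; [exact r0|exact Sk| |].
  + intros s Hs.
    destruct (Req_dec s 0) as [->|N]; [now rewrite Ropp_0|].
    assert (E1 := Hk s Hs); assert (E2 := Hk (- s) (Rball_opp r s Hs)).
    rewrite Ropp_involutive in E2.
    apply (Rmult_eq_reg_l s); [lra|exact N].
  + exists E, Q; split; [exact SE|split; [exact SQ|]].
    intros s Hs; rewrite <- HE, <- HQ by exact Hs.
    assert (E1 := Hk s Hs); lra.
Qed.

(** * Smooth maps of the plane that are affine in the second variable *)

(** Functions [a x + b x * y] have partial derivatives of the same shape.  Both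
    components of the diffeomorphism that straightens a cusp, and of its
    inverse, are of this form. *)
Lemma smooth_affine_in_y (D : R -> Prop) k : open D ->
  forall a b, smooth_on D a -> smooth_on D b ->
  forall x y, D x -> ex_diff_n (fun u v => a u + b u * v) k x y.
Proof.
intros oD.
assert (C1 : forall a x y, smooth_on D a -> D x ->
  continuity_2d_pt (fun u _ => a u) x y).
{ intros a x y Sa Dx; apply (continuity_1d_2d_pt_comp a (fun u _ => u)).
  - apply continuity_pt_filterlim; now apply (smooth_on_continuous D).
  - apply continuity_2d_pt_id1. }
assert (C2 : forall a b x y, smooth_on D a -> smooth_on D b -> D x ->
  continuity_2d_pt (fun u v => a u + b u * v) x y).
{ intros a b x y Sa Sb Dx; apply continuity_2d_pt_plus; [now apply C1|].
  apply continuity_2d_pt_mult; [now apply C1|apply continuity_2d_pt_id2]. }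
assert (Dab : forall a b x y, smooth_on D a -> smooth_on D b -> D x ->
  is_derive (fun z => a z + b z * y) x (Derive a x + Derive b x * y)).
{ intros a b x y Sa Sb Dx; auto_derive.
  - repeat split; now apply (smooth_on_ex_derive D).
  - change (Derive (fun x => a x)) with (Derive a).
    change (Derive (fun x => b x)) with (Derive b); ring. }
induction k as [|k IH]; intros a b Sa Sb x y Dx; simpl.
- split; [now apply C2|exact I].
- repeat split.
  + now apply C2.
  + eexists; now apply Dab.
  + auto_derive; exact I.
  + apply (ex_diff_n_ext_loc (fun u v => Derive a u + Derive b u * v)).
    * destruct (oD x Dx) as [e He]; exists e; intros u v Hu _.
      symmetry; apply is_derive_unique, Dab; auto; now apply He.
    * apply IH; auto; now apply smooth_on_Derive.
  + apply (ex_diff_n_ext_loc (fun u v => b u + 0 * v)).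
    * exists (mkposreal 1 Rlt_0_1); intros u v _ _.
      symmetry; apply is_derive_unique; auto_derive; [exact I|ring].
    * apply (IH b (fun _ => 0)); auto; now apply smooth_const.
Qed.

Lemma open_strip (D : R -> Prop) : open D -> open (fun z : plane => D (fst z)).
Proof.
intros oD z Dz; destruct (oD (fst z) Dz) as [e He].
exists e; intros w [Hw _]; now apply He.
Qed.

(** * Recognition of semicubic cusps *)

(** Applying Hadamard's lemma twice, [X = X t0 + (t - t0)^2 u] with [u t0 <> 0];
    [e] is the sign of [u t0] and [tau = (t - t0) sqrt (e u)] is a parameter. *)
Lemma morse_point X t0 r : 0 < r -> smooth_on (Rball t0 r) X ->
  Derive X t0 = 0 -> Derive_n X 2 t0 <> 0 ->
  exists e d K tau sigma, e * e = 1 /\ 0 < d <= r /\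
    diffeo1 (Rball t0 d) K tau sigma /\ tau t0 = 0 /\
    forall t, Rball t0 d t -> X t = X t0 + e * (tau t * tau t).
Proof.
intros r0 SX X1 X2.
assert (H0 : Rball t0 r t0) by now apply Rball_center.
destruct (hadamard t0 r X SX) as [g [Sg Hg]].
destruct (hadamard t0 r g Sg) as [u [Su Hu]].
assert (DX : forall t, Rball t0 r t -> Derive X t = g t + (t - t0) * Derive g t).
{ intros t Ht; rewrite (Derive_ext_loc _ (fun t => X t0 + (t - t0) * g t)).
  - apply is_derive_unique; auto_derive.
    + now apply (smooth_on_ex_derive (Rball t0 r)).
    + change (Derive (fun x => g x)) with (Derive g); ring.
  - apply (filter_imp (Rball t0 r)); [exact Hg|now apply open_Rball]. }
assert (g0 : g t0 = 0) by (rewrite DX in X1 by exact H0; lra).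
assert (g1 : Derive g t0 = u t0).
{ rewrite (Derive_ext_loc _ (fun t => g t0 + (t - t0) * u t)).
  - apply is_derive_unique; auto_derive.
    + now apply (smooth_on_ex_derive (Rball t0 r)).
    + change (Derive (fun x => u x)) with (Derive u); ring.
  - apply (filter_imp (Rball t0 r)); [exact Hu|now apply open_Rball]. }
assert (X2u : Derive_n X 2 t0 = 2 * u t0).
{ change (Derive_n X 2 t0) with (Derive (Derive X) t0).
  rewrite (Derive_ext_loc _ (fun t => g t + (t - t0) * Derive g t)).
  - apply is_derive_unique; auto_derive.
    + split; [now apply (smooth_on_ex_derive (Rball t0 r))|split; [|exact I]].
      apply (smooth_on_ex_derive (Rball t0 r) (Derive g)); [|exact H0].
      now apply smooth_on_Derive.
    + change (Derive (fun x => g x)) with (Derive g); rewrite g1; ring.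
  - apply (filter_imp (Rball t0 r)); [exact DX|now apply open_Rball]. }
assert (u0 : u t0 <> 0) by lra.
assert (He : exists e, e * e = 1 /\ 0 < e * u t0).
{ destruct (Rtotal_order (u t0) 0) as [L|[L|L]].
  - exists (-1); lra.
  - lra.
  - exists 1; lra. }
destruct He as [e [ee eu]].
assert (Hpos : exists r', 0 < r' <= r /\ forall t, Rball t0 r' t -> 0 < e * u t).
{ assert (Cu : continuous (fun t => e * u t) t0).
  { apply (smooth_on_continuous (Rball t0 r)); [|exact H0].
    apply smooth_scal; [apply open_Rball|exact Su]. }
  destruct (Cu (fun y => 0 < y)) as [d Hd]; [now apply open_pos|].
  exists (Rmin d r); split.
  - split; [apply Rmin_pos; [apply cond_pos|exact r0]|apply Rmin_r].
  - intros t Ht; apply Hd; eapply Rlt_le_trans; [exact Ht|apply Rmin_l]. }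
destruct Hpos as [r' [Hr' Hpos]].
assert (sub : forall t, Rball t0 r' t -> Rball t0 r t)
  by (unfold Rball; intros; lra).
set (tau := fun t => (t - t0) * sqrt (e * u t)).
assert (St : smooth_on (Rball t0 r') (fun t => sqrt (e * u t))).
{ apply (smooth_comp _ (fun x => 0 < x) sqrt); [apply open_Rball|apply smooth_sqrt| |].
  - apply smooth_scal; [apply open_Rball|now apply (smooth_on_sub (Rball t0 r))].
  - exact Hpos. }
assert (Stau : smooth_on (Rball t0 r') tau).
{ apply smooth_mult; [apply open_Rball| |exact St].
  apply smooth_minus; [apply open_Rball| |];
    [apply smooth_id|apply smooth_const]; apply open_Rball. }
assert (tau1 : 0 < Derive tau t0).
{ assert (H0' : Rball t0 r' t0) by now apply Rball_center.
  replace (Derive tau t0) with (sqrt (e * u t0)); [now apply sqrt_lt_R0|].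
  symmetry; unfold tau; apply is_derive_unique; auto_derive.
  - split; [now apply (smooth_on_ex_derive (Rball t0 r))|now split].
  - replace (t0 + - t0) with 0 by ring; ring. }
destruct (smooth_inverse tau t0 r') as [d [K [sigma [Hd HK]]]]; [lra|exact Stau|exact tau1|].
exists e, d, K, tau, sigma; repeat (split; [first [exact ee|lra|exact HK]|]).
split; [unfold tau; ring|].
intros t Ht.
assert (Ht' : Rball t0 r' t) by (unfold Rball in *; lra).
assert (Sq : sqrt (e * u t) * sqrt (e * u t) = e * u t)
  by (apply sqrt_sqrt; left; now apply Hpos).
rewrite (Hg t), (Hu t), g0 by now apply sub.
unfold tau.
replace ((t - t0) * sqrt (e * u t) * ((t - t0) * sqrt (e * u t))) with
  ((t - t0) * (t - t0) * (sqrt (e * u t) * sqrt (e * u t))) by ring.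
rewrite Sq.
replace (e * ((t - t0) * (t - t0) * (e * u t))) with
  ((e * e) * ((t - t0) * (t - t0) * u t)) by ring.
rewrite ee; ring.
Qed.

Lemma Rabs_sign_mult e x : e * e = 1 -> Rabs (e * x) = Rabs x.
Proof.
intros ee; rewrite Rabs_mult; replace (Rabs e) with 1; [ring|].
destruct (Rcase_abs e); [rewrite Rabs_left by lra|rewrite Rabs_pos_eq by lra]; nra.
Qed.

Lemma continuous_zero_off_center c r k : 0 < r -> continuous k c ->
  (forall s, Rball c r s -> s <> c -> k s = 0) -> k c = 0.
Proof.
intros r0 Ck Hk; destruct (Req_dec (k c) 0) as [|N]; [assumption|exfalso].
destruct (Ck (fun y => y <> 0)) as [d Hd]; [now apply open_neq0|].
set (m := Rmin d r); assert (0 < m) by (apply Rmin_pos; [apply cond_pos|exact r0]).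
assert (m <= d /\ m <= r) by (split; [apply Rmin_l|apply Rmin_r]).
assert (Em : Rabs (c + m / 2 - c) = m / 2).
{ replace (c + m / 2 - c) with (m / 2) by ring; apply Rabs_pos_eq; lra. }
apply (Hd (c + m / 2)).
- change (Rabs (c + m / 2 - c) < d); lra.
- apply Hk; [unfold Rball|]; lra.
Qed.

(** The function on the left of the last equation, call it [y], has derivative
    [2 e s (m(sigma s) - m t0)].  Write [y = E(s^2) + s Q(s^2)].
    Comparing derivatives at [0] gives [Q 0 = 0], hence [Q x = x W x].  Dividing
    the equality of derivatives by [s] and differentiating once more at [0]
    gives [3 W(0) = 2 e m'(t0) sigma'(0)], which is not zero. *)
Lemma even_odd_normal_form (c : R -> plane) (m : R -> R) t0 r sigma rho e :
  0 < r -> smooth_on (Rball t0 r) (xc c) -> smooth_on (Rball t0 r) (yc c) ->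
  smooth_on (Rball t0 r) m ->
  (forall t, Rball t0 r t -> Derive (yc c) t = m t * Derive (xc c) t) ->
  0 < rho -> e * e = 1 ->
  smooth_on (Rball 0 rho) sigma ->
  (forall s, Rball 0 rho s -> Rball t0 r (sigma s)) ->
  sigma 0 = t0 -> Derive sigma 0 <> 0 -> Derive m t0 <> 0 ->
  (forall s, Rball 0 rho s -> xc c (sigma s) = xc c t0 + e * (s * s)) ->
  exists E W, smooth_on (Rball 0 (rho * rho)) E /\
    smooth_on (Rball 0 (rho * rho)) W /\ W 0 <> 0 /\
    forall s, Rball 0 rho s ->
      yc c (sigma s) - yc c t0 - m t0 * (xc c (sigma s) - xc c t0)
      = E (s * s) + s ^ 3 * W (s * s).
Proof.
intros r0 SX SY Sm HY rho0 ee Ss Hs s0 s1 m1 HX.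
assert (oD := open_Rball 0 rho).
set (y := fun s => yc c (sigma s) - yc c t0 - m t0 * (xc c (sigma s) - xc c t0)).
assert (Sy : smooth_on (Rball 0 rho) y).
{ apply smooth_minus; [exact oD| |apply smooth_scal; [exact oD|]];
    (apply smooth_minus; [exact oD| |now apply smooth_const]).
  - now apply (smooth_comp _ (Rball t0 r) (yc c)).
  - now apply (smooth_comp _ (Rball t0 r) (xc c)). }
assert (Dy : forall s, Rball 0 rho s -> Derive y s = 2 * e * s * (m (sigma s) - m t0)).
{ intros s Bs.
  assert (Dsigma := smooth_on_is_derive _ sigma s Ss Bs).
  assert (DX := is_derive_comp (xc c) sigma s _ _
    (smooth_on_is_derive _ (xc c) (sigma s) SX (Hs s Bs)) Dsigma).
  assert (DY := is_derive_comp (yc c) sigma s _ _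
    (smooth_on_is_derive _ (yc c) (sigma s) SY (Hs s Bs)) Dsigma).
  assert (DX' : Derive sigma s * Derive (xc c) (sigma s) = 2 * e * s).
  { transitivity (Derive (fun s => xc c (sigma s)) s).
    - symmetry; now apply is_derive_unique.
    - rewrite (Derive_ext_loc _ (fun s => xc c t0 + e * (s * s))).
      + apply is_derive_unique; auto_derive; [exact I|ring].
      + apply (filter_imp (Rball 0 rho)); [exact HX|now apply oD]. }
  change (is_derive (fun s => yc c (sigma s)) s
    (Derive sigma s * Derive (yc c) (sigma s))) in DY.
  change (is_derive (fun s => xc c (sigma s)) s
    (Derive sigma s * Derive (xc c) (sigma s))) in DX.
  rewrite DX' in DX; rewrite HY in DY by now apply Hs.
  apply is_derive_unique.
  replace (2 * e * s * (m (sigma s) - m t0)) with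
    (Derive sigma s * (m (sigma s) * Derive (xc c) (sigma s)) - 0
      - m t0 * (2 * e * s - 0)) by (rewrite <- DX'; ring).
  apply (is_derive_minus (fun s => yc c (sigma s) - yc c t0)
    (fun s => m t0 * (xc c (sigma s) - xc c t0))).
  - apply (is_derive_minus (fun s => yc c (sigma s)) (fun _ => yc c t0)); [exact DY|].
    apply is_derive_Reals, derivable_pt_lim_const.
  - apply (is_derive_scal (fun s => xc c (sigma s) - xc c t0)).
    apply (is_derive_minus (fun s => xc c (sigma s)) (fun _ => xc c t0)); [exact DX|].
    apply is_derive_Reals, derivable_pt_lim_const. }
destruct (even_odd_splitting rho y rho0 Sy) as [E [Q [SE [SQ HEQ]]]].
destruct (hadamard 0 (rho * rho) Q SQ) as [W [SW HW]].
assert (B0 : Rball 0 rho 0) by now apply Rball_center.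
assert (B00 : Rball 0 (rho * rho) 0) by (apply Rball_center; nra).
assert (Dy' : forall s, Rball 0 rho s -> Derive y s =
  2 * s * Derive E (s * s) + Q (s * s) + 2 * (s * s) * Derive Q (s * s)).
{ intros s Bs; rewrite (Derive_ext_loc _ (fun s => E (s * s) + s * Q (s * s))).
  - apply is_derive_unique; auto_derive.
    + repeat split; apply (smooth_on_ex_derive (Rball 0 (rho * rho))); auto;
        now apply Rball_sqr.
    + change (Derive (fun x => E x)) with (Derive E).
      change (Derive (fun x => Q x)) with (Derive Q); ring.
  - apply (filter_imp (Rball 0 rho)); [exact HEQ|now apply oD]. }
assert (Q0 : Q 0 = 0).
{ assert (Z := Dy' 0 B0); rewrite Dy, !Rmult_0_l in Z by exact B0.
  rewrite !Rmult_0_r in Z; lra. }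
assert (HW' : forall x, Rball 0 (rho * rho) x -> Q x = x * W x).
{ intros x Bx; rewrite (HW x Bx), Q0; ring. }
assert (Q1 : Derive Q 0 = W 0).
{ rewrite (Derive_ext_loc _ (fun x => x * W x)).
  - apply is_derive_unique; auto_derive.
    + now apply (smooth_on_ex_derive (Rball 0 (rho * rho))).
    + ring.
  - apply (filter_imp (Rball 0 (rho * rho))); [exact HW'|now apply open_Rball]. }
exists E, W; split; [exact SE|split; [exact SW|split]].
2:{ intros s Bs; fold (y s).
    rewrite (HEQ s Bs), HW' by now apply Rball_sqr.
    ring. }
(* the difference of the two expressions of the derivative of [y], divided by [s] *)
set (k := fun s => 2 * Derive E (s * s) + s * W (s * s) + 2 * s * Derive Q (s * s)
  - 2 * e * (m (sigma s) - m t0)).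
assert (Dk : is_derive k 0 (3 * W 0 - 2 * e * (Derive m t0 * Derive sigma 0))).
{ unfold k; auto_derive.
  - rewrite !Rmult_0_l, s0; repeat split;
      [apply (smooth_on_ex_derive (Rball 0 (rho * rho)) (Derive E))
      |apply (smooth_on_ex_derive (Rball 0 (rho * rho)) W)
      |apply (smooth_on_ex_derive (Rball 0 (rho * rho)) (Derive Q))
      |apply (smooth_on_ex_derive (Rball t0 r) m)
      |apply (smooth_on_ex_derive (Rball 0 rho) sigma)];
      auto using smooth_on_Derive, Rball_center.
  - rewrite !Rmult_0_l, s0.
    change (Derive (fun x => Q x)) with (Derive Q).
    change (Derive (fun x => m x)) with (Derive m).
    change (Derive (fun x => sigma x)) with (Derive sigma).
    rewrite Q1; ring. }
assert (k0 : forall s, Rball 0 rho s -> s <> 0 -> k s = 0).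
{ intros s Bs Ns; unfold k.
  assert (Z := Dy' s Bs); rewrite (Dy s Bs) in Z.
  rewrite (HW' (s * s)) in Z by now apply Rball_sqr.
  apply (Rmult_eq_reg_l s); [|exact Ns]; lra. }
assert (k00 : k 0 = 0).
{ apply (continuous_zero_off_center 0 rho k rho0); [|exact k0].
  apply (ex_derive_continuous (V := R_NormedModule) k); eexists; exact Dk. }
assert (Dk' : is_derive k 0 0).
{ apply (is_derive_ext_loc (fun _ => 0)).
  - apply (filter_imp (Rball 0 rho)); [|now apply oD].
    intros s Bs; destruct (Req_dec s 0) as [->|N]; [now rewrite k00|].
    symmetry; now apply k0.
  - apply is_derive_Reals, derivable_pt_lim_const. }
apply is_derive_unique in Dk, Dk'; rewrite Dk' in Dk.
assert (P : e * (Derive m t0 * Derive sigma 0) <> 0).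
{ repeat apply Rmult_integral_contrapositive_currified; auto.
  intros Z; rewrite Z in ee; lra. }
lra.
Qed.

(** The germ is reduced to [(s^2, s^3)] by the shear
    [(x, y) |-> (x, (y - E x) / W x)] in the coordinates [x = e (X - X0)],
    [y = Y - Y0 - m0 (X - X0)]. *)
Lemma cusp_criterion (c : R -> plane) (m : R -> R) t0 r :
  0 < r -> smooth_on (Rball t0 r) (xc c) -> smooth_on (Rball t0 r) (yc c) ->
  smooth_on (Rball t0 r) m ->
  (forall t, Rball t0 r t -> Derive (yc c) t = m t * Derive (xc c) t) ->
  Derive (xc c) t0 = 0 -> Derive_n (xc c) 2 t0 <> 0 -> Derive m t0 <> 0 ->
  semicubic_cusp c t0.
Proof.
intros r0 SX SY Sm HY X1 X2 m1.
destruct (morse_point (xc c) t0 r r0 SX X1 X2)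
  as [e [d [K [tau [sigma [ee [Hd [HK [tau0 HX]]]]]]]]].
destruct HK as [oJ [oK [HJ [HKJ [Stau Ssigma]]]]].
assert (J0 : Rball t0 d t0) by (apply Rball_center; lra).
assert (K0 : K 0) by (rewrite <- tau0; now apply HJ).
assert (sigma0 : sigma 0 = t0) by (rewrite <- tau0; now apply HJ).
destruct (open_contains_Rball K 0 oK K0) as [rho [rho0 HrhoK]].
assert (s1 : Derive sigma 0 <> 0).
{ assert (Dst : is_derive (fun t => sigma (tau t)) t0 (Derive tau t0 * Derive sigma 0)).
  { apply (is_derive_comp sigma tau).
    - rewrite tau0; now apply (smooth_on_is_derive K).
    - now apply (smooth_on_is_derive (Rball t0 d)). }
  assert (Did : is_derive (fun t => sigma (tau t)) t0 1).
  { apply (is_derive_ext_loc (fun t => t)).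
    - apply (filter_imp (Rball t0 d)); [|now apply oJ].
      intros t Ht; symmetry; now apply HJ.
    - apply is_derive_Reals, derivable_pt_lim_id. }
  apply is_derive_unique in Dst, Did; rewrite Did in Dst.
  intros Z; rewrite Z in Dst; lra. }
assert (HXs : forall s, Rball 0 rho s -> xc c (sigma s) = xc c t0 + e * (s * s)).
{ intros s Bs; destruct (HKJ s (HrhoK s Bs)) as [H1 H2].
  rewrite (HX _ H1), H2; reflexivity. }
destruct (even_odd_normal_form c m t0 r sigma rho e) as [E [W [SE [SW [W0 HEW]]]]]; auto.
{ now apply (smooth_on_sub K). }
{ intros s Bs; destruct (HKJ s (HrhoK s Bs)) as [H1 _]; unfold Rball in *; lra. }
assert (B00 : Rball 0 (rho * rho) 0) by (apply Rball_center; nra).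
assert (Hrho1 : exists rho1, 0 < rho1 <= rho * rho /\
  forall x, Rball 0 rho1 x -> W x <> 0).
{ assert (CW : continuous W 0) by now apply (smooth_on_continuous (Rball 0 (rho * rho))).
  destruct (CW (fun y => y <> 0)) as [d1 Hd1]; [now apply open_neq0|].
  exists (Rmin d1 (rho * rho)); split.
  - split; [apply Rmin_pos; [apply cond_pos|nra]|apply Rmin_r].
  - intros t Ht; apply Hd1; eapply Rlt_le_trans; [exact Ht|apply Rmin_l]. }
destruct Hrho1 as [rho1 [Hrho1 HW]].
assert (sub1 : forall x, Rball 0 rho1 x -> Rball 0 (rho * rho) x)
  by (unfold Rball; intros; lra).
set (X0 := xc c t0) in *; set (Y0 := yc c t0) in *; set (m0 := m t0) in *.
set (h := fun X => e * (X - X0)).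
assert (hball : forall X, Rball X0 rho1 X -> Rball 0 rho1 (h X)).
{ unfold Rball, h; intros X HX1.
  replace (e * (X - X0) - 0) with (e * (X - X0)) by ring.
  rewrite Rabs_sign_mult by exact ee; lra. }
assert (oB := open_Rball X0 rho1); assert (oB' := open_Rball 0 rho1).
assert (Sh : smooth_on (Rball X0 rho1) h).
{ apply smooth_scal; [exact oB|].
  apply smooth_minus; [exact oB|now apply smooth_id|now apply smooth_const]. }
assert (SWh : smooth_on (Rball X0 rho1) (fun X => W (h X))).
{ apply (smooth_comp _ (Rball 0 rho1) W); auto;
  now apply (smooth_on_sub (Rball 0 (rho * rho))). }
assert (SEh : smooth_on (Rball X0 rho1) (fun X => E (h X))).
{ apply (smooth_comp _ (Rball 0 rho1) E); auto;
  now apply (smooth_on_sub (Rball 0 (rho * rho))). }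
exists (fun z => Rball X0 rho1 (fst z)), (fun w => Rball 0 rho1 (fst w)).
exists (fun z => (h (fst z),
  (snd z - Y0 - m0 * (fst z - X0) - E (h (fst z))) / W (h (fst z)))).
exists (fun w => (X0 + e * fst w, Y0 + m0 * (e * fst w) + E (fst w) + W (fst w) * snd w)).
exists (Rball t0 d), K, tau, sigma.
assert (he : forall x, h (X0 + e * x) = x).
{ intros x; unfold h; replace (e * (X0 + e * x - X0)) with (e * e * x) by ring.
  rewrite ee; ring. }
assert (eh : forall X, X0 + e * h X = X).
{ intros X; unfold h; replace (e * (e * (X - X0))) with (e * e * (X - X0)) by ring.
  rewrite ee; ring. }
split; [|split; [|split; [|split; [|split]]]].
- split; [now apply open_strip|split; [now apply open_strip|]].
  split; [|split; [|split]].
  + intros [X Y] HX1; cbn [fst snd] in *; split; [now apply hball|].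
    rewrite eh; f_equal.
    replace (e * h X) with (X - X0) by (rewrite <- (eh X) at 1; ring).
    field; now apply HW, hball.
  + intros [x y] Hx; cbn [fst snd] in *; split.
    * unfold Rball in *; replace (X0 + e * x - X0) with (e * x) by ring.
      replace (x - 0) with x in Hx by ring.
      rewrite Rabs_sign_mult by exact ee; lra.
    * rewrite he; f_equal; field; now apply HW.
  + split; intros [X Y] k HX1; cbn [fst snd] in *.
    * apply (ex_diff_n_ext_loc (fun u v => h u + 0 * v)).
      -- exists (mkposreal 1 Rlt_0_1); intros; ring.
      -- apply (smooth_affine_in_y (Rball X0 rho1) k oB h (fun _ => 0)); auto.
         now apply smooth_const.
    * apply (ex_diff_n_ext_loc (fun u v =>
        (- Y0 - m0 * (u - X0) - E (h u)) / W (h u) + / W (h u) * v)).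
      -- destruct (oB X HX1) as [d1 Hd1]; exists d1; intros u v Hu _.
         field; apply HW, hball, Hd1, Hu.
      -- apply (smooth_affine_in_y (Rball X0 rho1) k oB
           (fun u => (- Y0 - m0 * (u - X0) - E (h u)) / W (h u)) (fun u => / W (h u))); auto.
         ++ apply smooth_div; auto.
            apply smooth_minus; auto; apply smooth_minus; auto.
            ** now apply smooth_const.
            ** apply smooth_scal; auto.
               apply smooth_minus; [exact oB|now apply smooth_id|now apply smooth_const].
         ++ apply smooth_inv; auto.
  + split; intros [x y] k Hx; cbn [fst snd] in *.
    * apply (ex_diff_n_ext_loc (fun u v => (X0 + e * u) + 0 * v)).
      -- exists (mkposreal 1 Rlt_0_1); intros; ring.
      -- apply (smooth_affine_in_y (Rball 0 rho1) k oB' (fun u => X0 + e * u) (fun _ => 0)); auto.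
         ++ now apply smooth_affine.
         ++ now apply smooth_const.
    * apply (smooth_affine_in_y (Rball 0 rho1) k oB'
        (fun u => Y0 + m0 * (e * u) + E u) W); auto.
      -- apply smooth_plus; auto; [|now apply (smooth_on_sub (Rball 0 (rho * rho)))].
         apply (smooth_on_ext _ (fun u => Y0 + (m0 * e) * u)); auto.
         ++ intros; ring.
         ++ now apply smooth_affine.
      -- now apply (smooth_on_sub (Rball 0 (rho * rho))).
- apply Rball_center; lra.
- split; [exact oJ|split; [exact oK|]].
  split; [exact HJ|split; [exact HKJ|split; [exact Stau|exact Ssigma]]].
- exact J0.
- exact tau0.
- assert (Hdelta : 0 < Rmin rho (Rmin 1 rho1)).
  { repeat apply Rmin_pos; lra. }
  exists (mkposreal _ Hdelta); intros s Hs.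
  change (Rabs (s - 0) < Rmin rho (Rmin 1 rho1)) in Hs.
  assert (Bs : Rball 0 rho s) by (eapply Rlt_le_trans; [exact Hs|apply Rmin_l]).
  assert (Hs1 : Rabs s < Rmin 1 rho1).
  { rewrite Rminus_0_r in Hs; eapply Rlt_le_trans; [exact Hs|apply Rmin_r]. }
  assert (Hs2 : Rabs s < 1) by (eapply Rlt_le_trans; [exact Hs1|apply Rmin_l]).
  assert (Hs3 : Rabs s < rho1) by (eapply Rlt_le_trans; [exact Hs1|apply Rmin_r]).
  assert (Bss : Rball 0 rho1 (s * s)).
  { unfold Rball; rewrite Rminus_0_r, Rabs_mult; pose proof (Rabs_pos s); nra. }
  change (fst (c (sigma s))) with (xc c (sigma s)).
  change (snd (c (sigma s))) with (yc c (sigma s)).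
  assert (HH := HEW s Bs).
  split.
  + rewrite (HXs s Bs); unfold Rball in *.
    replace (X0 + e * (s * s) - X0) with (e * (s * s)) by ring.
    rewrite Rminus_0_r in Bss.
    rewrite Rabs_sign_mult by exact ee; lra.
  + rewrite (HEW s Bs), (HXs s Bs), he.
    f_equal; [ring|].
    field; now apply HW.
Qed.

(** * The dual curve and the contact condition *)

Lemma open_itv a b : open (itv a b).
Proof.
apply open_and; [now apply open_Rbar_gt|now apply open_Rbar_lt].
Qed.

Lemma zero_by_density (D P : R -> Prop) k t :
  (forall (t : R) (eps : posreal), D t -> exists s, D s /\ ball t eps s /\ P s) ->
  (forall s, D s -> P s -> k s = 0) -> continuous k t -> D t -> k t = 0.
Proof.
intros dense Hk Ck Dt; destruct (Req_dec (k t) 0) as [|N]; [assumption|exfalso].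
destruct (Ck (fun y => y <> 0)) as [d Hd]; [now apply open_neq0|].
destruct (dense t d Dt) as [s [Ds [Bs Ps]]].
now apply (Hd s Bs), Hk.
Qed.

(** The second equation is the defining equation of the slope cleared of its
    denominator, which makes it valid also where [x' = 0]. *)
Lemma dual_equations (D : R -> Prop) c d :
  smooth_curve D c -> is_dual D c d ->
  forall t, D t ->
    yc d t = xc c t * xc d t - yc c t /\
    Derive (yc c) t = xc d t * Derive (xc c) t.
Proof.
intros [Sx Sy] [L [[dense [HL [Hs Cs]]] [Hd [Sdx Sdy]]]].
assert (Hp : forall t, D t -> xc d t = slope (L t) /\
  yc d t = xc c t * slope (L t) - yc c t).
{ intros t Dt; assert (E := HL t Dt).
  unfold xc, yc; rewrite <- E, (Hd t Dt).
  unfold front, slope, Legendre; now destruct (L t) as [[x y] p]. }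
intros t Dt; split.
- destruct (Hp t Dt) as [-> ->]; reflexivity.
- apply Rminus_diag_uniq.
  apply (zero_by_density D (fun s => Derive (xc c) s <> 0)
    (fun s => Derive (yc c) s - xc d s * Derive (xc c) s) t dense).
  + intros s Ds Ns; destruct (Hp s Ds) as [-> _]; rewrite (Hs s Ds Ns); field; exact Ns.
  + apply (continuous_minus (V := R_NormedModule) (Derive (yc c))
      (fun s => xc d s * Derive (xc c) s)).
    * apply (smooth_on_continuous D); [now apply smooth_on_Derive|exact Dt].
    * apply (continuous_mult (K := R_AbsRing) (xc d) (Derive (xc c)));
        apply (smooth_on_continuous D); auto; now apply smooth_on_Derive.
  + exact Dt.
Qed.

(** Differentiating [Y = x X - y] leaves [x X'] because [x' X = y'].  So [x] is
    the slope of the dual curve. *)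
Lemma dual_contact (D : R -> Prop) c d : open D ->
  smooth_curve D c -> is_dual D c d ->
  forall t, D t -> Derive (yc d) t = xc c t * Derive (xc d) t.
Proof.
intros oD Sc Hd t Dt.
assert (Eq := dual_equations D c d Sc Hd).
destruct Sc as [Sx Sy]; destruct Hd as [L [_ [_ [Sdx Sdy]]]].
rewrite (Derive_ext_loc _ (fun t => xc c t * xc d t - yc c t)).
- apply is_derive_unique; auto_derive.
  + repeat split; now apply (smooth_on_ex_derive D).
  + change (Derive (fun x => xc c x)) with (Derive (xc c)).
    change (Derive (fun x => yc c x)) with (Derive (yc c)).
    change (Derive (fun x => xc d x)) with (Derive (xc d)).
    rewrite (proj2 (Eq t Dt)); ring.
- apply (filter_imp D); [intros s Ds; now apply Eq|now apply oD].
Qed.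

(** The slope of the dual curve and [x] agree where [X' <> 0], hence everywhere;
    the second coordinate is then [X x - Y = y]. *)
Lemma double_dual (D : R -> Prop) c d dd : open D ->
  smooth_curve D c -> is_dual D c d -> is_dual D d dd ->
  forall t, D t -> dd t = c t.
Proof.
intros oD Sc Hd Hdd t Dt.
assert (Sd : smooth_curve D d) by now destruct Hd as [L [_ [_ Sd]]].
assert (Cont := dual_contact D c d oD Sc Hd).
assert (E1 := dual_equations D c d Sc Hd).
assert (E2 := dual_equations D d dd Sd Hdd).
destruct Hdd as [L [[dense _] [_ [Sddx _]]]].
assert (Ex : xc dd t = xc c t).
{ apply Rminus_diag_uniq.
  apply (zero_by_density D (fun s => Derive (xc d) s <> 0)
    (fun s => xc dd s - xc c s) t dense).
  - intros s Ds Ns.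
    apply (Rmult_eq_reg_r (Derive (xc d) s)); [|exact Ns].
    rewrite Rmult_0_l, Rmult_minus_distr_r, <- (Cont s Ds), (proj2 (E2 s Ds)); ring.
  - apply (continuous_minus (V := R_NormedModule) (xc dd) (xc c));
      apply (smooth_on_continuous D); auto; apply Sc.
  - exact Dt. }
assert (Ey : yc dd t = yc c t).
{ rewrite (proj1 (E2 t Dt)), Ex, (proj1 (E1 t Dt)); ring. }
unfold xc, yc in Ex, Ey.
destruct (dd t), (c t); simpl in *; now subst.
Qed.

(** The numerator of the curvature, and also that of the derivative of the
    slope. *)
(** * Curvature and the shape of the dual curve *)

Definition wronskian (c : R -> plane) (t : R) : R :=
  Derive (xc c) t * Derive_n (yc c) 2 t - Derive (yc c) t * Derive_n (xc c) 2 t.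

Lemma smooth_wronskian D c : open D -> smooth_curve D c -> smooth_on D (wronskian c).
Proof.
intros oD [Sx Sy]; unfold wronskian.
apply (smooth_minus D (fun t => Derive (xc c) t * Derive (Derive (yc c)) t)
  (fun t => Derive (yc c) t * Derive (Derive (xc c)) t)); auto;
  apply smooth_mult; auto using smooth_on_Derive.
Qed.

Lemma Derive_dual_x (D : R -> Prop) c d t : open D ->
  smooth_curve D c -> is_dual D c d -> D t -> Derive (xc c) t <> 0 ->
  Derive (xc d) t = wronskian c t / Derive (xc c) t ^ 2.
Proof.
intros oD Sc Hd Dt Nt.
assert (Eq := dual_equations D c d Sc Hd).
destruct Sc as [Sx Sy].
assert (Cx : continuous (Derive (xc c)) t)
  by (apply (smooth_on_continuous D); [now apply smooth_on_Derive|exact Dt]).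
rewrite (Derive_ext_loc _ (fun t => Derive (yc c) t / Derive (xc c) t)).
- apply is_derive_unique; unfold wronskian.
  change (Derive_n (yc c) 2) with (Derive (Derive (yc c))).
  change (Derive_n (xc c) 2) with (Derive (Derive (xc c))).
  replace (_ / _) with ((Derive (Derive (yc c)) t * Derive (xc c) t
    - Derive (yc c) t * Derive (Derive (xc c)) t) / Derive (xc c) t ^ 2)
    by (field; exact Nt).
  apply (is_derive_div (Derive (yc c)) (Derive (xc c))); [| |exact Nt];
    apply (smooth_on_is_derive D); auto using smooth_on_Derive.
- apply (filter_imp (fun s => D s /\ Derive (xc c) s <> 0)).
  + intros s [Ds Ns]; rewrite (proj2 (Eq s Ds)); field; exact Ns.
  + apply filter_and; [now apply oD|].
    apply (Cx (fun y => y <> 0)); now apply open_neq0.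
Qed.

Lemma curvature_wronskian c t : curvature c t =
  wronskian c t * / exp (3 / 2 * ln (Derive (xc c) t ^ 2 + Derive (yc c) t ^ 2)).
Proof. reflexivity. Qed.

Lemma curvature_0 c t : curvature c t = 0 <-> wronskian c t = 0.
Proof.
rewrite curvature_wronskian.
assert (P := exp_pos (3 / 2 * ln (Derive (xc c) t ^ 2 + Derive (yc c) t ^ 2))).
apply Rinv_0_lt_compat in P; split; intros H.
- apply Rmult_integral in H; lra.
- rewrite H; ring.
Qed.

(** At a zero of the curvature the derivative of its denominator does not
    contribute. *)
Lemma Derive_curvature_flat (D : R -> Prop) c t : open D -> smooth_curve D c -> D t ->
  Derive (xc c) t <> 0 -> wronskian c t = 0 ->
  Derive (curvature c) t = Derive (wronskian c) t *
    / exp (3 / 2 * ln (Derive (xc c) t ^ 2 + Derive (yc c) t ^ 2)).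
Proof.
intros oD Sc Dt Nt W0.
assert (SW := smooth_wronskian D c oD Sc); destruct Sc as [Sx Sy].
set (v := fun t => / exp (3 / 2 * ln (Derive (xc c) t ^ 2 + Derive (yc c) t ^ 2))).
assert (Ev : ex_derive v t).
{ assert (Ex := smooth_on_ex_derive D _ t (smooth_on_Derive D _ Sx) Dt).
  assert (Ey := smooth_on_ex_derive D _ t (smooth_on_Derive D _ Sy) Dt).
  unfold v; auto_derive.
  repeat split; auto.
  - pose proof (pow2_ge_0 (Derive (yc c) t)).
    assert (0 < Derive (xc c) t ^ 2) by (apply pow2_gt_0; exact Nt).
    simpl in *; lra.
  - apply Rgt_not_eq, exp_pos. }
destruct Ev as [l Hl].
transitivity (Derive (fun t => wronskian c t * v t) t); [reflexivity|].
apply is_derive_unique.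
fold (v t).
replace (Derive (wronskian c) t * v t) with
  (Derive (wronskian c) t * v t + wronskian c t * l) by (rewrite W0; ring).
apply (is_derive_mult (wronskian c) v); [|exact Hl|intros; apply Rmult_comm].
now apply (smooth_on_is_derive D).
Qed.

Lemma dual_regular_at (D : R -> Prop) c d t : open D ->
  smooth_curve D c -> is_dual D c d -> D t -> Derive (xc c) t <> 0 ->
  curvature c t <> 0 -> regular_at d t.
Proof.
intros oD Sc Hd Dt Nt K [X1 _]; apply K, curvature_0.
rewrite (Derive_dual_x D c) in X1 by assumption.
apply Rmult_integral in X1; destruct X1 as [|X1]; [assumption|].
exfalso; revert X1; apply Rinv_neq_0_compat, pow_nonzero, Nt.
Qed.

(** The derivative of [X] is the wronskian divided by [x'^2], so a simple zero of
    the curvature is a simple zero of [X'].  The slope [x] of the dual curve has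
    nonzero derivative, and the recognition criterion applies. *)
Lemma dual_cusp_at (D : R -> Prop) c d t : open D ->
  smooth_curve D c -> is_dual D c d -> D t -> Derive (xc c) t <> 0 ->
  curvature c t = 0 -> Derive (curvature c) t <> 0 -> semicubic_cusp d t.
Proof.
intros oD Sc Hd Dt Nt K0 K1.
apply curvature_0 in K0.
rewrite (Derive_curvature_flat D) in K1 by assumption.
assert (W1 : Derive (wronskian c) t <> 0) by (intros Z; apply K1; rewrite Z; ring).
assert (SW := smooth_wronskian D c oD Sc).
assert (HX := Derive_dual_x D c d).
assert (HY := dual_contact D c d oD Sc Hd).
destruct (open_contains_Rball D t oD Dt) as [r [r0 Hr]].
assert (Sd : smooth_curve D d) by now destruct Hd as [L [_ [_ Sd]]].
apply (cusp_criterion d (xc c) t r); auto.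
- now apply (smooth_on_sub D); [|apply Sd].
- now apply (smooth_on_sub D); [|apply Sd].
- now apply (smooth_on_sub D); [|apply Sc].
- rewrite HX, K0 by assumption; unfold Rdiv; ring.
- change (Derive_n (xc d) 2 t) with (Derive (Derive (xc d)) t).
  assert (Cx : continuous (Derive (xc c)) t).
  { apply (smooth_on_continuous D); [apply smooth_on_Derive, Sc|exact Dt]. }
  rewrite (Derive_ext_loc _ (fun s => wronskian c s / Derive (xc c) s ^ 2)).
  + rewrite Derive_div.
    * rewrite K0; unfold Rdiv; rewrite Rmult_0_l, Rminus_0_r.
      assert (Derive (xc c) t ^ 2 <> 0) by now apply pow_nonzero.
      apply Rmult_integral_contrapositive_currified.
      -- now apply Rmult_integral_contrapositive_currified.
      -- now apply Rinv_neq_0_compat, pow_nonzero.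
    * now apply (smooth_on_ex_derive D).
    * apply (smooth_on_ex_derive D); [|exact Dt].
      apply smooth_pow; [exact oD|apply smooth_on_Derive, Sc].
    * now apply pow_nonzero.
  + apply (filter_imp (fun s => D s /\ Derive (xc c) s <> 0)).
    * intros s [Ds Ns]; now apply HX.
    * apply filter_and; [now apply oD|].
      apply (Cx (fun y => y <> 0)); now apply open_neq0.
Qed.

(** * Leading terms of the dual of a graph *)

Lemma has_leading_term_intro g cf m :
  (forall eps : posreal, locally 0 (fun t => Rabs (g t - cf * t ^ m) <= eps * Rabs (t ^ m)))
  <-> has_leading_term g cf m.
Proof. split; intros H eps; exact (H eps). Qed.

Lemma has_leading_term_ext g h cf m : locally 0 (fun t => g t = h t) ->
  has_leading_term g cf m -> has_leading_term h cf m.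
Proof.
rewrite <- !has_leading_term_intro; intros E H eps.
specialize (H eps); generalize (filter_and _ _ E H); apply filter_imp.
intros t [<- Ht]; exact Ht.
Qed.

Lemma has_leading_term_minus g h c1 c2 m :
  has_leading_term g c1 m -> has_leading_term h c2 m ->
  has_leading_term (fun t => g t - h t) (c1 - c2) m.
Proof.
rewrite <- !has_leading_term_intro; intros H1 H2 eps.
assert (He : 0 < eps / 2) by (pose proof (cond_pos eps); lra).
specialize (H1 (mkposreal _ He)); specialize (H2 (mkposreal _ He)).
generalize (filter_and _ _ H1 H2); apply filter_imp; simpl; intros t [A1 A2].
replace (g t - h t - (c1 - c2) * t ^ m) with
  ((g t - c1 * t ^ m) + - (h t - c2 * t ^ m)) by ring.
eapply Rle_trans; [apply Rabs_triang|]; rewrite Rabs_Ropp; lra.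
Qed.

Lemma has_leading_term_mul_id g cf m :
  has_leading_term g cf m -> has_leading_term (fun t => t * g t) cf (S m).
Proof.
rewrite <- !has_leading_term_intro; intros H eps; specialize (H eps).
revert H; apply filter_imp; intros t Ht; cbn [pow].
replace (t * g t - cf * (t * t ^ m)) with (t * (g t - cf * t ^ m)) by ring.
rewrite !Rabs_mult; pose proof (Rabs_pos t); nra.
Qed.

(** By the mean value theorem, [f t - c / (n+1) t^(n+1)] is [t] times the
    remainder of the derivative at an intermediate point. *)
Lemma has_leading_term_primitive (D : R -> Prop) f cf n :
  open D -> D 0 -> smooth_on D f -> f 0 = 0 ->
  has_leading_term (Derive f) cf n -> has_leading_term f (cf / INR (S n)) (S n).
Proof.
rewrite <- !has_leading_term_intro; intros oD D0 Sf f0 H eps.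
destruct (H eps) as [d1 Hd1].
destruct (open_contains_Rball D 0 oD D0) as [d2 [d20 Hd2]].
assert (Hd : 0 < Rmin d1 d2) by (apply Rmin_pos; [apply cond_pos|exact d20]).
exists (mkposreal _ Hd); intros t Ht; change (Rabs (t - 0) < Rmin d1 d2) in Ht.
rewrite Rminus_0_r in Ht.
assert (Rabs t < d1) by (eapply Rlt_le_trans; [exact Ht|apply Rmin_l]).
assert (Rabs t < d2) by (eapply Rlt_le_trans; [exact Ht|apply Rmin_r]).
assert (Hz : forall z, Rmin 0 t <= z <= Rmax 0 t -> Rabs z <= Rabs t).
{ intros z; unfold Rmin, Rmax; destruct (Rle_dec 0 t); intros Hz.
  - rewrite !Rabs_pos_eq; lra.
  - rewrite !Rabs_left1; lra. }
assert (HD : forall z, Rmin 0 t <= z <= Rmax 0 t ->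
  is_derive (fun t => f t - cf / INR (S n) * t ^ S n) z (Derive f z - cf * z ^ n)).
{ intros z Bz; specialize (Hz z Bz); auto_derive.
  - apply (smooth_on_ex_derive D); [exact Sf|].
    apply Hd2; unfold Rball; rewrite Rminus_0_r; lra.
  - change (Derive (fun x => f x)) with (Derive f).
    change (match n with 0%nat => 1 | S _ => INR n + 1 end) with (INR (S n)).
    field; apply not_0_INR; lia. }
destruct (MVT_gen (fun t => f t - cf / INR (S n) * t ^ S n) 0 t
  (fun z => Derive f z - cf * z ^ n)) as [z [Bz E]].
- intros z Bz; apply HD; lra.
- intros z Bz; apply continuity_pt_filterlim.
  apply (ex_derive_continuous (V := R_NormedModule) (fun t => f t - cf / INR (S n) * t ^ S n)).
  eexists; now apply HD.
- rewrite f0, pow_ne_zero in E by lia.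
  rewrite Rmult_0_r, !Rminus_0_r in E; rewrite E.
  cbn [pow]; rewrite !Rabs_mult, (Rmult_comm (Rabs t)), <- Rmult_assoc.
  apply Rmult_le_compat_r; [apply Rabs_pos|].
  specialize (Hz z Bz).
  eapply Rle_trans; [apply Hd1; change (Rabs (z - 0) < d1); rewrite Rminus_0_r; lra|].
  apply Rmult_le_compat_l; [left; apply cond_pos|].
  rewrite <- !RPow_abs; apply pow_incr; split; [apply Rabs_pos|exact Hz].
Qed.

(** Taylor's formula with Peano's remainder, by integrating the formula for the
    derivative. *)
Lemma peano_leading_term (D : R -> Prop) n : open D -> D 0 -> forall f,
  smooth_on D f -> (forall k, (k < n)%nat -> Derive_n f k 0 = 0) ->
  has_leading_term f (Derive_n f n 0 / INR (fact n)) n.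
Proof.
intros oD D0; induction n as [|n IH]; intros f Sf Hf.
- apply has_leading_term_intro; intros eps; simpl.
  assert (C := smooth_on_continuous D f 0 Sf D0).
  destruct (C (ball (f 0) eps)) as [d Hd]; [apply locally_ball|].
  exists d; intros t Ht; specialize (Hd t Ht).
  change (Rabs (f t - f 0) < eps) in Hd.
  replace (f t - f 0 / 1 * 1) with (f t - f 0) by field.
  rewrite Rabs_R1; lra.
- replace (Derive_n f (S n) 0 / INR (fact (S n))) with
    (Derive_n (Derive f) n 0 / INR (fact n) / INR (S n)).
  + apply (has_leading_term_primitive D); auto; [apply (Hf 0%nat); lia|].
    apply IH; [now apply smooth_on_Derive|].
    intros k kn; rewrite (Derive_n_comp f k 1), Nat.add_1_r; apply Hf; lia.
  + rewrite (Derive_n_comp f n 1), Nat.add_1_r, fact_simpl, mult_INR.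
    field; split; [apply INR_fact_neq_0|apply not_0_INR; lia].
Qed.

Lemma graph_dual_exists (D : R -> Prop) f : open D -> smooth_on D f ->
  exists d, is_dual D (graph f) d.
Proof.
intros oD Sf; exists (fun t => (Derive f t, t * Derive f t - f t)).
exists (fun t => (t, f t, Derive f t)); split; [|split].
- assert (D1 : forall t, Derive (xc (graph f)) t = 1) by (intros t; apply Derive_id).
  split; [|split; [|split]].
  + intros t eps Dt; exists t; split; [exact Dt|split; [apply ball_center|]].
    rewrite D1; lra.
  + reflexivity.
  + intros t _ _; rewrite D1; simpl; change (yc (graph f)) with (fun x => f x).
    change (Derive (fun x => f x) t) with (Derive f t); field.
  + intros t Dt; apply (smooth_on_continuous D (Derive f)); [|exact Dt].
    now apply smooth_on_Derive.
- reflexivity.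
- split.
  + now apply (smooth_on_Derive D f).
  + apply (smooth_minus D (fun t => t * Derive f t) f); auto.
    apply (smooth_mult D (fun t => t)); auto using smooth_on_Derive, smooth_id.
Qed.

Lemma graph_dual_leading_terms (D : R -> Prop) n f d :
  open D -> D 0 -> (1 <= n)%nat -> smooth_on D f ->
  (forall k, (k <= n)%nat -> Derive_n f k 0 = 0) -> Derive_n f (S n) 0 <> 0 ->
  is_dual D (graph f) d ->
  exists alpha beta, alpha * beta <> 0 /\
    has_leading_term (xc d) alpha n /\ has_leading_term (yc d) beta (S n).
Proof.
intros oD D0 n1 Sf Hf fn Hd.
assert (Sg : smooth_curve D (graph f)).
{ split; [apply (smooth_id D oD)|exact Sf]. }
assert (Eq := dual_equations D (graph f) d Sg Hd).
assert (EX : forall t, D t -> Derive f t = xc d t).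
{ intros t Dt; destruct (Eq t Dt) as [_ E].
  change (Derive (xc (graph f)) t) with (Derive (fun x => x) t) in E.
  rewrite Derive_id, Rmult_1_r in E; exact E. }
assert (EY : forall t, D t -> t * Derive f t - f t = yc d t).
{ intros t Dt; rewrite (EX t Dt); symmetry; apply (Eq t Dt). }
set (c := Derive_n f (S n) 0) in *.
assert (Lf : has_leading_term f (c / INR (fact (S n))) (S n)).
{ apply (peano_leading_term D (S n)); auto; intros k kn; apply Hf; lia. }
assert (Lf' : has_leading_term (Derive f) (c / INR (fact n)) n).
{ replace c with (Derive_n (Derive f) n 0)
    by (rewrite (Derive_n_comp f n 1), Nat.add_1_r; reflexivity).
  apply (peano_leading_term D n); auto using smooth_on_Derive.
  intros k kn; rewrite (Derive_n_comp f k 1), Nat.add_1_r; apply Hf; lia. }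
exists (c / INR (fact n)), (c / INR (fact n) - c / INR (fact (S n))).
split; [|split].
- assert (F1 := INR_fact_neq_0 n).
  assert (F2 : INR (S n) <> 0) by (apply not_0_INR; lia).
  replace (c / INR (fact n) - c / INR (fact (S n))) with
    (c * INR n / (INR (S n) * INR (fact n))).
  2:{ rewrite fact_simpl, mult_INR, S_INR in *; field; auto. }
  assert (INR n <> 0) by (apply not_0_INR; lia).
  unfold Rdiv; repeat apply Rmult_integral_contrapositive_currified; auto;
    try apply Rinv_neq_0_compat; auto.
- apply (has_leading_term_ext (Derive f)); [|exact Lf'].
  apply (filter_imp D); [exact EX|now apply oD].
- apply (has_leading_term_ext (fun t => t * Derive f t - f t)).
  + apply (filter_imp D); [exact EY|now apply oD].
  + apply has_leading_term_minus; [now apply has_leading_term_mul_id|exact Lf].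
Qed.

(** * The theorem *)

Theorem lemma1 :
  (forall (a b : Rbar) (gamma gammas : R -> plane) (t0 : R),
     smooth_curve (itv a b) gamma ->
     is_dual (itv a b) gamma gammas ->
     itv a b t0 ->
     Derive (xc gamma) t0 <> 0 ->
     (curvature gamma t0 <> 0 -> regular_at gammas t0) /\
     (curvature gamma t0 = 0 -> Derive (curvature gamma) t0 <> 0 ->
        semicubic_cusp gammas t0))
  /\
  (forall (n : nat) (a b : Rbar) (f : R -> R),
     (1 <= n)%nat ->
     itv a b 0 ->
     smooth_on (itv a b) f ->
     (forall k : nat, (k <= n)%nat -> Derive_n f k 0 = 0) ->
     Derive_n f (S n) 0 <> 0 ->
     (exists gammas : R -> plane, is_dual (itv a b) (graph f) gammas) /\
     (forall gammas : R -> plane,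
        is_dual (itv a b) (graph f) gammas ->
        exists alpha beta : R,
          alpha * beta <> 0 /\
          has_leading_term (xc gammas) alpha n /\
          has_leading_term (yc gammas) beta (S n)))
  /\
  ((forall j : J1, Legendre (Legendre j) = j) /\
   (forall (a b : Rbar) (gamma gammas gammass : R -> plane),
      smooth_curve (itv a b) gamma ->
      is_dual (itv a b) gamma gammas ->
      is_dual (itv a b) gammas gammass ->
      forall t : R, itv a b t -> gammass t = gamma t)).
Proof.
split; [|split; [|split]].
- intros a b gamma gammas t0 Sc Hd Dt Nt; split.
  + now apply (dual_regular_at (itv a b) gamma gammas); [apply open_itv|..].
  + now apply (dual_cusp_at (itv a b) gamma gammas); [apply open_itv|..].
- intros n a b f n1 D0 Sf Hf fn; split.
  + apply graph_dual_exists; [apply open_itv|exact Sf].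
  + intros gammas Hd; apply (graph_dual_leading_terms (itv a b) n f); auto.
    apply open_itv.
- intros [[x y] p]; simpl; f_equal; f_equal; ring.
- intros a b gamma gammas gammass Sc Hd Hdd.
  now apply (double_dual (itv a b) gamma gammas gammass); [apply open_itv|..].
Qed.
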